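(* Let $A$ be a regular ring containing a field $k$ with $1/2\in k$, $\dim A=d$, and let $P$ be a projective $A$-module of rank $n$ with $2n\geq d+2$. Let $\mathbf{e}_0=\zeta_0(0,0,0)$ and $\mathbf{e}_1=\zeta_0(0,0,1)$ in $\pi_0(\widetilde Q(P))$. Then: (1) the addition $+$ on $\pi_0(\widetilde Q(P))$ is commutative and associative, and $\mathbf{e}_1$ is an additive identity, so $\pi_0(\widetilde Q(P))$ is an abelian monoid; (2) for every $x\in\pi_0(\widetilde Q(P))$, $x+\widetilde\Gamma(x)=\mathbf{e}_0$; (3) if $\mathbf{e}_0=\mathbf{e}_1$, then $\pi_0(\widetilde Q(P))$ is an abelian group under $+$; in particular this holds if $P\cong Q\oplus A$ for some projective $A$-module $Q$.
   Context: All rings are commutative. $P^*=\mathrm{Hom}_A(P,A)$ and $P[T]=P\otimes_AA[T]$. Let $\widetilde{Q}(P)=\{(f,p,s)\in P^*\oplus P\oplus A: f(p)+s(s-1)=0\}$, and define $\widetilde Q(P[T])$ likewise. $\pi_0(\widetilde Q(P))$ is the quotient of $\widetilde Q(P)$ by the equivalence relation generated by $H(0)\sim H(1)$ for $H(T)\in\widetilde Q(P[T])$; $\zeta_0$ is the quotient map. A local $P$-orientation is a pair $(I,\omega)$, $I\subseteq A$ an ideal and $\omega:P\to I/I^2$ surjective; $\mathcal{LO}(P)$ is their set. Define $\eta(f,p,s)=(f(P)+As,\omega)$ with $\omega$ induced by $f$. $\zeta:\mathcal{LO}(P)\to\pi_0(\widetilde Q(P))$ sends $(I,\omega)$ to $\zeta_0(u)$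 for any $u$ with $\eta(u)=(I,\omega)$; this is well defined. For $I+J=A$, $\omega_I\star\omega_J:P\to IJ/(IJ)^2$ is the unique surjection inducing $\omega_I$ and $\omega_J$. The map $\Gamma(f,p,s)=(f,p,1-s)$ on $\widetilde Q(P)$ induces a well-defined involution $\widetilde\Gamma$ of $\pi_0(\widetilde Q(P))$. Addition: for $x,y\in\pi_0(\widetilde Q(P))$ one can choose $(K,\omega_K),(I,\omega_I)\in\mathcal{LO}(P)$ with $x=\zeta(K,\omega_K)$, $y=\zeta(I,\omega_I)$, $I+K=A$ and $\operatorname{height}K\geq n$. One defines $x+y=\zeta(KI,\omega_K\star\omega_I)$; this does not depend on the choices. *)

(* Defs.v *)
From mathcomp Require Import all_boot all_algebra.
From Stdlib Require Import Relations ClassicalEpsilon.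
Set Implicit Arguments. Unset Strict Implicit. Unset Printing Implicit Defensive.
Import GRing.Theory.
Local Open Scope ring_scope.

Section Ring.
Variable A : comNzRingType.

Definition is_ideal (I : A -> Prop) : Prop :=
  I 0 /\ (forall x y, I x -> I y -> I (x + y)) /\ (forall a x, I x -> I (a * x)).
Definition is_prime (I : A -> Prop) : Prop :=
  is_ideal I /\ ~ I 1 /\ (forall x y, I (x * y) -> I x \/ I y).
Definition strict_sub (I J : A -> Prop) : Prop :=
  (forall x, I x -> J x) /\ exists x, J x /\ ~ I x.
Definition prime_chain (c : nat -> A -> Prop) (len : nat) : Prop :=
  (forall i, (i <= len)%N -> is_prime (c i)) /\
  (forall i, (i < len)%N -> strict_sub (c i) (c i.+1)).
Definition krull_dim (d : nat) : Prop :=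
  (exists c, prime_chain c d) /\ ~ (exists c, prime_chain c d.+1).
Definition same_ideal (I J : A -> Prop) : Prop := forall x, I x <-> J x.
Definition height_eq (p : A -> Prop) (h : nat) : Prop :=
  (exists c, prime_chain c h /\ same_ideal (c h) p) /\
  ~ (exists c, prime_chain c h.+1 /\ same_ideal (c h.+1) p).
Definition height_ge (K : A -> Prop) (n : nat) : Prop :=
  forall p, is_prime p -> (forall x, K x -> p x) ->
    exists c, prime_chain c n /\ same_ideal (c n) p.
Definition span (a : seq A) (x : A) : Prop :=
  exists b : seq A, size b = size a /\ x = \sum_(i < size a) b`_i * a`_i.
Definition noetherian : Prop :=
  forall I, is_ideal I -> exists a : seq A, same_ideal I (span a).
(* the images of a in A_p generate the maximal ideal p A_p *)
Definition loc_gen (p : A -> Prop) (a : seq A) : Prop :=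
  (forall i, (i < size a)%N -> p a`_i) /\
  (forall x, p x -> exists s, ~ p s /\ span a (s * x)).
(* A_p is a regular local ring for every prime p: dim A_p (= height p) equals
   the minimal number of generators of p A_p *)
Definition regular_ring : Prop :=
  noetherian /\
  forall p, is_prime p -> exists h, height_eq p h /\
    (exists a, size a = h /\ loc_gen p a) /\
    (forall a, loc_gen p a -> (h <= size a)%N).

Definition prodI (I J : A -> Prop) (a : A) : Prop :=
  exists r : seq (A * A), (forall t, t \in r -> I t.1 /\ J t.2) /\
    a = \sum_(t <- r) t.1 * t.2.
Definition sqI (I : A -> Prop) := prodI I I.
End Ring.

Section Module.
Variable A : comNzRingType.

Definition is_linear (U V : lmodType A) (f : U -> V) : Prop :=
  forall a x y, f (a *: x + y) = a *: f x + f y.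
Definition fg_projective (P : lmodType A) : Prop :=
  exists m (i : P -> 'rV[A]_m) (q : 'rV[A]_m -> P),
    is_linear i /\ is_linear q /\ forall x, q (i x) = x.
(* P_p is free of rank n over A_p (stated without constructing A_p) *)
Definition free_at (P : lmodType A) (p : A -> Prop) (n : nat) : Prop :=
  exists e : seq P, size e = n /\
   (forall x : P, exists s, ~ p s /\ exists b : seq A, size b = n /\
        s *: x = \sum_(i < n) b`_i *: e`_i) /\
   (forall b : seq A, size b = n ->
      (exists s, ~ p s /\ s *: (\sum_(i < n) b`_i *: e`_i) = 0) ->
      forall i, (i < n)%N -> exists s, ~ p s /\ s * b`_i = 0).
Definition proj_rank (P : lmodType A) (n : nat) : Prop :=
  forall p, is_prime p -> free_at P p n.

Variable P : lmodType A.

Definition linf (f : P -> A) : Prop :=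
  forall a x y, f (a *: x + y) = a * f x + f y.
Definition rawT := ((P -> A) * P * A)%type.
Definition QtP (u : rawT) : Prop :=
  linf u.1.1 /\ u.1.1 u.1.2 + u.2 * (u.2 - 1) = 0.
(* triples for P[T]: Hom_{A[T]}(P[T],A[T]) = Hom_A(P,A[T]); an element of P[T]
   is given by its coefficient sequence q (sum_j q_j T^j) *)
Definition rawTT := ((P -> {poly A}) * seq P * {poly A})%type.
Definition QTT (H : rawTT) : Prop :=
  (forall a x y, H.1.1 (a *: x + y) = a%:P * H.1.1 x + H.1.1 y) /\
  \sum_(j < size H.1.2) H.1.1 (H.1.2)`_j * 'X^j + H.2 * (H.2 - 1) = 0.
Definition ev0 (H : rawTT) : rawT :=
  (fun x => (H.1.1 x).[0], (H.1.2)`_0, H.2.[0]).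
Definition ev1 (H : rawTT) : rawT :=
  (fun x => (H.1.1 x).[1], \sum_(j < size H.1.2) (H.1.2)`_j, H.2.[1]).
Definition htp (u v : rawT) : Prop := exists H, QTT H /\ ev0 H = u /\ ev1 H = v.
Definition Z0 (u : rawT) : rawT -> Prop := fun v => clos_refl_sym_trans rawT htp u v.
Definition isPi0 (C : rawT -> Prop) : Prop := exists u, QtP u /\ C = Z0 u.

Definition raw0 : rawT := (fun _ => 0, 0, 0).
Definition raw1 : rawT := (fun _ => 0, 0, 1).
Definition e0 := Z0 raw0.
Definition e1 := Z0 raw1.

(* local orientations (I, omega): omega represented by a linear w : P -> A
   with values in I, inducing a surjection P -> I/I^2 *)
Definition LO (I : A -> Prop) (w : P -> A) : Prop :=
  is_ideal I /\ linf w /\ (forall x, I (w x)) /\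
  (forall a, I a -> exists x, sqI I (a - w x)).
Definition eta_eq (u : rawT) (I : A -> Prop) (w : P -> A) : Prop :=
  same_ideal (fun a => exists x c, a = u.1.1 x + c * u.2) I /\
  forall x, sqI I (u.1.1 x - w x).
Definition Zeta (I : A -> Prop) (w : P -> A) (C : rawT -> Prop) : Prop :=
  exists u, QtP u /\ eta_eq u I w /\ C = Z0 u.

Definition Add (n : nat) (x y z : rawT -> Prop) : Prop :=
  exists K wK I wI w,
    LO K wK /\ LO I wI /\ Zeta K wK x /\ Zeta I wI y /\
    (exists a b, K a /\ I b /\ a + b = 1) /\ height_ge K n /\
    LO (prodI K I) w /\ (forall v, sqI K (w v - wK v)) /\
    (forall v, sqI I (w v - wI v)) /\ Zeta (prodI K I) w z.

Definition addPi (n : nat) (x y : rawT -> Prop) : rawT -> Prop :=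
  epsilon (inhabits e0) (fun z => isPi0 z /\ Add n x y z).

Definition Gam (u : rawT) : rawT := (u.1.1, u.1.2, 1 - u.2).
Definition GamPi (x : rawT -> Prop) : rawT -> Prop :=
  epsilon (inhabits e0) (fun y => exists u, QtP u /\ x = Z0 u /\ y = Z0 (Gam u)).
End Module.

(* Main.v *)
(** A triple [u = (f, p, s)] of the quadric is kept with the ideal [I(u) = f(P) + A s], and the sum
    of two triples with comaximal ideals is a triple lying over the product ideal. By Nakayama
    applied to [f0 + T (f1 - f0)] over [A[T]], the class of a triple depends only on its local
    orientation. The substitution [f + (1 - s)^2 h], with [s] and [p] corrected by [h(p)], moves
    [I(u)] within the homotopy class of [u], and an Eisenbud-Evans argument provides an [h] that
    puts [I(u)] in general position: of height at least [n] and comaximal with given ideals [K] of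
    height at least [n], because [dim A/K <= n - 2].

    The sum is independent of all choices because a whole homotopy [H] can be moved off [K[T]],
    which works since [dim (A/K)[T] <= n - 1]; the values of [h] at [T = 0, 1] can be prescribed, so
    successive homotopies match, and multiplying the moved homotopy by [K] gives a homotopy between
    the two sums. Commutativity, associativity and the identity are then read off from the ideals,
    [I(u)] and [I(Gamma u)] are comaximal with product [f(P)], so that [u + Gamma u] is the class of
    [(f, 0, 0) ~ (0, 0, 0)].

    [P] is represented as the image
    of an idempotent matrix [E], which makes the triples over [A[T]] triples for the same matrix. *)
Require Import Defs.
From HB Require Import structures.
From mathcomp Require Import all_boot all_algebra ring zify.
From Stdlib Require Import Relations Classical ClassicalEpsilon FunctionalExtensionality PropExtensionality.
Import GRing.Theory.
Set Implicit Arguments. Unset Strict Implicit. Unset Printing Implicit Defensive.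
Local Open Scope ring_scope.


(** The factor [(1 - s)^2] in the move costs nothing: the new [s'] satisfies
    [1 - s' = (1 - s) (1 - h(p))], so [1 - s] is nonzero in the residue field of every prime that
    contains the moved ideal, and there the functional can be changed in all directions. The
    inequality [2n >= d + 2] bounds chains of primes: a prime over an ideal [K] of height at least
    [n] ends a chain of length [n], so a chain of length [n - 1] above [K] would prolong it to
    length [2n - 1 >= d + 1]. Moving a single triple off [K] only needs chains of length [n] to be
    excluded; the spare unit pays for the variable [T] in the homotopies. *)

Lemma pred_ext (T : Type) (X Y : T -> Prop) : (forall x, X x <-> Y x) -> X = Y.
Proof.
by move=> h; apply: functional_extensionality => x; apply: propositional_extensionality.
Qed.

(** * Ideals and noetherian rings *)

Section Ideals.
Variable R : comNzRingType.
Implicit Types I J K : R -> Prop.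

Lemma ideal0 I : is_ideal I -> I 0. Proof. by case. Qed.
Lemma idealD I x y : is_ideal I -> I x -> I y -> I (x + y).
Proof. by case=> _ [h _]; apply: h. Qed.
Lemma ideal_mull I a x : is_ideal I -> I x -> I (a * x).
Proof. by case=> _ [_ h]; apply: h. Qed.
Lemma ideal_mulr I a x : is_ideal I -> I x -> I (x * a).
Proof. by rewrite mulrC; apply: ideal_mull. Qed.
Lemma idealN I x : is_ideal I -> I x -> I (- x).
Proof. by move=> hI Ix; rewrite -mulN1r; apply: ideal_mull. Qed.
Lemma idealB I x y : is_ideal I -> I x -> I y -> I (x - y).
Proof. by move=> hI Ix Iy; apply: idealD => //; apply: idealN. Qed.
Lemma ideal_sum I (T : Type) (r : seq T) (P : pred T) (F : T -> R) :
  is_ideal I -> (forall i, P i -> I (F i)) -> I (\sum_(i <- r | P i) F i).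
Proof.
move=> hI hF; apply: big_ind => //; first exact: ideal0.
by move=> x y; apply: idealD.
Qed.
Lemma ideal_eq_sub I x y : is_ideal I -> I (x - y) -> I y -> I x.
Proof. by move=> hI hxy Iy; rewrite -(subrK y x); apply: idealD. Qed.

Lemma span_ideal (a : seq R) : is_ideal (Defs.span a).
Proof.
split; last split.
- exists (nseq (size a) 0); rewrite size_nseq; split=> //.
  by rewrite big1 // => i _; rewrite nth_nseq ltn_ord mul0r.
- move=> x y [b [sb ->]] [c [sc ->]].
  exists (mkseq (fun i => b`_i + c`_i) (size a)); rewrite size_mkseq; split=> //.
  by rewrite -big_split; apply: eq_bigr => i _; rewrite nth_mkseq // mulrDl.
- move=> r x [b [sb ->]].
  exists (mkseq (fun i => r * b`_i) (size a)); rewrite size_mkseq; split=> //.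
  by rewrite mulr_sumr; apply: eq_bigr => i _; rewrite nth_mkseq // mulrA.
Qed.

Lemma span_nth (a : seq R) i : (i < size a)%N -> Defs.span a a`_i.
Proof.
move=> hi; exists (mkseq (fun j => (j == i)%:R) (size a)); rewrite size_mkseq; split=> //.
rewrite (bigD1 (Ordinal hi)) //= nth_mkseq // eqxx mul1r big1 ?addr0 // => j hj.
by rewrite nth_mkseq // -[(j == i :> nat)]/(j == Ordinal hi) (negPf hj) mul0r.
Qed.

Lemma span_sub (a : seq R) I : is_ideal I ->
  (forall i, (i < size a)%N -> I a`_i) -> forall x, Defs.span a x -> I x.
Proof.
move=> hI ha x [b [sb ->]]; apply: ideal_sum => // i _.
by apply: ideal_mull => //; apply: ha.
Qed.

Definition addI I J (x : R) : Prop := exists y z, I y /\ J z /\ x = y + z.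

Lemma addI_ideal I J : is_ideal I -> is_ideal J -> is_ideal (addI I J).
Proof.
move=> hI hJ; split; last split.
- by exists 0, 0; rewrite addr0; split; [exact: ideal0 | split => //; exact: ideal0].
- move=> x y [a [b [Ia [Jb ->]]]] [c [d [Ic [Jd ->]]]].
  by exists (a + c), (b + d); split; [exact: idealD | split; [exact: idealD | rewrite addrACA]].
- move=> r x [a [b [Ia [Jb ->]]]].
  by exists (r * a), (r * b); split; [exact: ideal_mull | split; [exact: ideal_mull | rewrite mulrDr]].
Qed.
Lemma addI_l I J x : is_ideal J -> I x -> addI I J x.
Proof. by move=> hJ Ix; exists x, 0; rewrite addr0; split=> //; split=> //; apply: ideal0. Qed.
Lemma addI_r I J x : is_ideal I -> J x -> addI I J x.
Proof. by move=> hI Jx; exists 0, x; rewrite add0r; split=> //; apply: ideal0. Qed.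

Definition prinI (a x : R) : Prop := exists b, x = b * a.
Lemma prinI_ideal a : is_ideal (prinI a).
Proof.
split; last split.
- by exists 0; rewrite mul0r.
- by move=> x y [b ->] [c ->]; exists (b + c); rewrite mulrDl.
- by move=> r x [b ->]; exists (r * b); rewrite mulrA.
Qed.
Lemma prinI_id a : prinI a a. Proof. by exists 1; rewrite mul1r. Qed.

Lemma prodI_mul I J x y : I x -> J y -> prodI I J (x * y).
Proof.
move=> Ix Jy; exists [:: (x, y)]; rewrite big_seq1; split=> // t.
by rewrite inE => /eqP ->.
Qed.

Lemma prodI_ideal I J : is_ideal I -> is_ideal (prodI I J).
Proof.
move=> hI; split; last split.
- by exists [::]; rewrite big_nil.
- move=> x y [r [hr ->]] [s [hs ->]]; exists (r ++ s); rewrite big_cat; split=> //.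
  by move=> t; rewrite mem_cat => /orP [/hr|/hs].
- move=> a x [r [hr ->]]; exists [seq (a * t.1, t.2) | t <- r]; split.
    by move=> t /mapP [u /hr [h1 h2] ->]; split=> //=; apply: ideal_mull.
  by rewrite big_map mulr_sumr; apply: eq_bigr => t _; rewrite mulrA.
Qed.

Lemma prodI_sub I J K : is_ideal K -> (forall x y, I x -> J y -> K (x * y)) ->
  forall z, prodI I J z -> K z.
Proof.
move=> hK h z [r [hr ->]]; rewrite big_seq_cond; apply: ideal_sum => // t.
by rewrite andbT => /hr [h1 h2]; apply: h.
Qed.

Lemma prodI_mono I J I' J' : is_ideal I' -> (forall x, I x -> I' x) -> (forall x, J x -> J' x) ->
  forall z, prodI I J z -> prodI I' J' z.
Proof.
move=> hI' hI hJ; apply: prodI_sub; first exact: prodI_ideal.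
by move=> x y Ix Jy; apply: prodI_mul; auto.
Qed.

Lemma sqI_sub I x : is_ideal I -> sqI I x -> I x.
Proof. by move=> hI; apply: prodI_sub => // y z _; apply: ideal_mull. Qed.

Lemma capI_ideal I J : is_ideal I -> is_ideal J -> is_ideal (fun x => I x /\ J x).
Proof.
move=> hI hJ; split; first by split; apply: ideal0.
split=> [y z [Iy Jy] [Iz Jz]|c y [Iy Jy]]; first by split; apply: idealD.
by split; apply: ideal_mull.
Qed.

Definition comax I J := exists a b, I a /\ J b /\ a + b = 1.

Lemma comaxC I J : comax I J -> comax J I.
Proof. by move=> [a [b [Ia [Jb h]]]]; exists b, a; rewrite addrC. Qed.

Lemma comax_prodE I J : is_ideal I -> is_ideal J -> comax I J ->
  prodI I J = (fun x => I x /\ J x).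
Proof.
move=> hI hJ [a [b [Ia [Jb h]]]]; apply: pred_ext => x; split.
  apply: (@prodI_sub _ _ (fun z => I z /\ J z)) => [|y z Iy Jz]; first exact: capI_ideal.
  by split; [apply: ideal_mulr | apply: ideal_mull].
move=> [Ix Jx]; rewrite -(mulr1 x) -h mulrDr; apply: idealD; first exact: prodI_ideal.
  by rewrite mulrC; apply: prodI_mul.
exact: prodI_mul.
Qed.

Lemma comax_cap I J K : is_ideal I -> is_ideal J -> is_ideal K ->
  comax I K -> comax J K -> comax (fun x => I x /\ J x) K.
Proof.
move=> hI hJ hK [a [b [Ia [Kb h]]]] [c [d [Jc [Kd h']]]].
exists (a * c), (a * d + b); split; first by split; [apply: ideal_mulr | apply: ideal_mull].
split; first by apply: idealD => //; apply: ideal_mull.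
by rewrite addrA -mulrDr h' mulr1.
Qed.

Lemma comax_sq I J : is_ideal I -> is_ideal J -> comax I J -> comax (sqI I) (sqI J).
Proof.
move=> hI hJ [a [b [Ia [Jb h]]]].
have hI2 := prodI_ideal I hI; have hJ2 := prodI_ideal J hJ.
(* These are the two halves of the expansion of [(a + b)^3 = 1]. *)
exists (a * a * (a + b *+ 3)), (b * b * (a *+ 3 + b)); split.
  by apply: ideal_mulr => //; apply: prodI_mul.
split; first by apply: ideal_mulr => //; apply: prodI_mul.
rewrite -[RHS](expr1n _ 3) -h; ring.
Qed.

(** The squares are again comaximal, so their intersection is their product, which lies in the
    square of [I J], and [I J] is the intersection of [I] and [J]. *)
Lemma comax_sq_cap I J x : is_ideal I -> is_ideal J -> comax I J ->
  sqI I x -> sqI J x -> sqI (fun y => I y /\ J y) x.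
Proof.
move=> hI hJ hc; have hI2 := prodI_ideal I hI; have hJ2 := prodI_ideal J hJ.
have h2 := comax_sq hI hJ hc; move=> Ix Jx.
have: prodI (sqI I) (sqI J) x by rewrite comax_prodE.
rewrite -comax_prodE //; have hp := prodI_ideal J hI; have hp2 := prodI_ideal (prodI I J) hp.
apply: prodI_sub => // y z hy hz; move: y hy.
apply: (@prodI_sub _ _ (fun y => sqI (prodI I J) (y * z))).
  split; last split; first by rewrite mul0r; apply: ideal0.
  - by move=> u v hu hv; rewrite mulrDl; apply: idealD.
  - by move=> c u hu; rewrite -mulrA; apply: ideal_mull.
move=> y1 y2 h1 h1'; move: z hz.
apply: (@prodI_sub _ _ (fun z => sqI (prodI I J) (y1 * y2 * z))).
  split; last split; first by rewrite mulr0; apply: ideal0.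
  - by move=> u v hu hv; rewrite mulrDr; apply: idealD.
  - by move=> c u hu; rewrite mulrCA; apply: ideal_mull.
by move=> z1 z2 h3 h3'; rewrite mulrACA; apply: prodI_mul; apply: prodI_mul.
Qed.

Lemma sqI_mono I J x : is_ideal J -> (forall y, I y -> J y) -> sqI I x -> sqI J x.
Proof. by move=> hJ h; apply: prodI_mono. Qed.

Lemma prime_ideal I : is_prime I -> is_ideal I. Proof. by case. Qed.

Lemma prime_mulN I x y : is_prime I -> ~ I x -> ~ I y -> ~ I (x * y).
Proof. by move=> [_ [_ h]] nx ny /h []. Qed.

(* Generators of [M] are eliminated one at a time. *)
Lemma nakayama M N (a : seq R) : is_ideal M -> is_ideal N -> same_ideal M (Defs.span a) ->
  (forall x, M x -> addI N (sqI M) x) ->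
  exists e, M e /\ forall x, M x -> N ((1 - e) * x).
Proof.
move=> hM hN hMa hNM.
have Ma i : (i < size a)%N -> M a`_i by move=> hi; apply/hMa/span_nth.
suff: forall k, (k <= size a)%N -> exists e, M e /\
    forall x, M x -> addI N (Defs.span (drop k a)) ((1 - e) * x).
  move/(_ _ (leqnn _)) => [e [Me he]]; exists e; split=> // x /he [y [z [Ny [hz ->]]]].
  suff ->: z = 0 by rewrite addr0.
  by move: hz => [b []]; rewrite drop_size big_ord0.
elim=> [_|k IH hk].
  exists 0; split; first exact: ideal0.
  by move=> x Mx; rewrite subr0 mul1r drop0; apply: addI_r => //; apply/hMa.
have [e [Me he]] := IH (ltnW hk).
have hNk := addI_ideal hN (span_ideal (drop k.+1 a)).
have hspan z : Defs.span (drop k a) z -> exists c w, Defs.span (drop k.+1 a) w /\ z = c * a`_k + w.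
  apply: (@span_sub _ (fun z => exists c w, Defs.span (drop k.+1 a) w /\ z = c * a`_k + w)) => [|i].
    split; last split.
    - by exists 0, 0; rewrite mul0r addr0; split=> //; apply: (ideal0 (span_ideal _)).
    - move=> x y [c [w [hw ->]]] [c' [w' [hw' ->]]]; exists (c + c'), (w + w').
      by split; [apply: (idealD (span_ideal _)) | rewrite mulrDl addrACA].
    - move=> r x [c [w [hw ->]]]; exists (r * c), (r * w).
      by split; [apply: (ideal_mull _ (span_ideal _)) | rewrite mulrDr mulrA].
  rewrite (drop_nth 0) //=; case: i => [_|i hi] /=.
    by exists 1, 0; rewrite mul1r addr0; split=> //; apply: (ideal0 (span_ideal _)).
  by exists 0, (drop k.+1 a)`_i; rewrite mul0r add0r; split=> //; apply: span_nth.
(* Write [a_k] as an element of [N + M^2] and multiply by [1 - e]. In a product [x * z] the factor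
   [(1 - e) * z] is known modulo [N] and the generators from [k] on, so the coefficient of [a_k]
   picks up [x] and lies in [M]. *)
have [m [Mm hm]] : exists m, M m /\ addI N (Defs.span (drop k.+1 a)) ((1 - e - m) * a`_k).
  have [y [z [Ny [hz hak]]]] := hNM _ (Ma _ hk).
  pose Q z := exists m, M m /\ addI N (Defs.span (drop k.+1 a)) ((1 - e) * z - m * a`_k).
  have: Q z.
    move: z hz {hak}; apply: (@prodI_sub _ _ Q) => [|x z Mx Mz].
      split; last split.
      - exists 0; split; first exact: ideal0.
        by rewrite mulr0 mul0r subr0; apply: (ideal0 hNk).
      - move=> x z [m [Mm hm]] [m' [Mm' hm']]; exists (m + m'); split; first exact: idealD.
        have ->: (1 - e) * (x + z) - (m + m') * a`_k = ((1 - e) * x - m * a`_k) + ((1 - e) * z - m' * a`_k) by ring.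
        exact: (idealD hNk).
      - move=> r x [m [Mm hm]]; exists (r * m); split; first exact: ideal_mull.
        by rewrite mulrCA -mulrA -mulrBr; apply: (ideal_mull _ hNk).
    have [y' [z' [Ny' [/hspan [c [w [hw ->]]] hz']]]] := he _ Mz.
    exists (x * c); split; first exact: ideal_mulr.
    have ->: (1 - e) * (x * z) - x * c * a`_k = x * y' + x * w by rewrite mulrCA hz'; ring.
    by exists (x * y'), (x * w); split; [apply: ideal_mull | split=> //; apply: (ideal_mull _ (span_ideal _))].
  move=> [m [Mm hm]]; exists m; split=> //; rewrite mulrBl {1}hak mulrDr -addrA.
  by apply: (idealD hNk) => //; apply: addI_l; [exact: span_ideal | exact: ideal_mull].
(* The new multiplier is [(1 - e - m) * (1 - e)]: the second factor leaves the generators from [k]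
   on, the first then removes [a_k]. *)
exists (1 - (1 - e - m) * (1 - e)); split.
  have ->: 1 - (1 - e - m) * (1 - e) = e + (e + m) * (1 - e).
    by ring.
  by apply: idealD => //; apply: ideal_mulr => //; apply: idealD.
move=> x Mx; rewrite opprB addrC subrK -mulrA.
have [y [z [Ny [/hspan [c [w [hw ->]]] ->]]]] := he _ Mx.
rewrite 2!mulrDr; apply: (idealD hNk); first by apply: addI_l; [exact: span_ideal | exact: ideal_mull].
apply: (idealD hNk); first by rewrite mulrCA; apply: (ideal_mull _ hNk).
by apply: addI_r => //; apply: (ideal_mull _ (span_ideal _)).
Qed.

End Ideals.

Section Noetherian.
Variable R : comNzRingType.
Hypothesis Rnoeth : noetherian R.
Implicit Types I J K : R -> Prop.

Lemma noeth_ascending (I : nat -> R -> Prop) : (forall n, is_ideal (I n)) ->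
  (forall n x, I n x -> I n.+1 x) -> exists n, forall x, I n.+1 x -> I n x.
Proof.
move=> hI hS.
have hm n k x : I n x -> I (n + k)%N x.
  by move=> h; elim: k => [|k IH]; rewrite ?addn0 ?addnS //; apply: hS.
pose U x := exists n, I n x.
have hU : is_ideal U.
  split; last split.
  - by exists 0%N; apply: ideal0.
  - move=> x y [n hx] [k hy]; exists (n + k)%N; apply: idealD => //; first exact: hm.
    by rewrite addnC; apply: hm.
  - by move=> r x [n hx]; exists n; apply: ideal_mull.
have [a ha] := Rnoeth hU.
have [n hn] : exists n, forall i, (i < size a)%N -> I n a`_i.
  have: forall i, (i < size a)%N -> U a`_i by move=> i hi; apply/ha/span_nth.
  elim: (a) => [_|b s IH h]; first by exists 0%N.
  have [n1 h1] := IH (fun i hi => h i.+1 hi); have [n2 h2] := h 0%N isT.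
  exists (n1 + n2)%N => -[_|i hi] /=; last by apply: hm; apply: h1.
  by rewrite addnC; apply: hm.
exists n => x hx; apply: (span_sub (hI n) hn); apply/ha; by exists n.+1.
Qed.

(** Dependent choice would turn a counterexample into a strictly ascending sequence of ideals. *)
Lemma noeth_ind (P : (R -> Prop) -> Prop) :
  (forall I, is_ideal I -> (forall J, is_ideal J -> strict_sub I J -> P J) -> P I) ->
  forall I, is_ideal I -> P I.
Proof.
move=> hP I0 hI0; apply: NNPP => nP0.
pose bad := {I : R -> Prop | is_ideal I /\ ~ P I}.
have step (b : bad) : {b' : bad | strict_sub (sval b) (sval b')}.
  apply: constructive_indefinite_description; case: b => I [hI nP] /=.
  apply: NNPP => h; apply: nP; apply: hP => // J hJ hIJ; apply: NNPP => nPJ.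
  by apply: h; exists (exist _ J (conj hJ nPJ)).
pose b0 : bad := exist _ I0 (conj hI0 nP0).
pose b n := iter n (fun c => sval (step c)) b0.
have hb n : strict_sub (sval (b n)) (sval (b n.+1)) by exact: (svalP (step (b n))).
have [n hn] := @noeth_ascending (fun n => sval (b n)) (fun n => proj1 (svalP (b n)))
  (fun n => proj1 (hb n)).
by have [_ [x [/hn]]] := hb n.
Qed.

Lemma nonprime_split I : is_ideal I -> ~ I 1 -> ~ is_prime I ->
  exists x y, [/\ ~ I x, ~ I y & I (x * y)].
Proof.
move=> hI h1 np; apply: NNPP => h; apply: np; split=> //; split=> // x y hxy.
have [hx|hx] := classic (I x); first by left.
by right; apply: NNPP => hy; apply: h; exists x, y.
Qed.

Lemma strict_add I x : is_ideal I -> ~ I x -> strict_sub I (addI I (prinI x)).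
Proof.
move=> hI hx; split=> [y Iy|]; first by apply: addI_l => //; apply: prinI_ideal.
by exists x; split=> //; apply: addI_r => //; apply: prinI_id.
Qed.

Lemma add_prin_mul I x y u v : is_ideal I -> I (x * y) ->
  addI I (prinI x) u -> addI I (prinI y) v -> I (u * v).
Proof.
move=> hI hxy [a [b [Ia [[c ->] ->]]]] [a' [b' [Ia' [[c' ->] ->]]]].
rewrite mulrDl; apply: idealD => //; first exact: ideal_mulr.
rewrite mulrDr; apply: idealD => //; first exact: ideal_mull.
by rewrite mulrACA; apply: ideal_mull.
Qed.

(** Noetherian induction in place of Zorn's lemma: if [x * y] is in [I] and both [I + (x)] and
    [I + (y)] contain 1, then so does [I]. *)
Lemma prime_over I : is_ideal I -> ~ I 1 -> exists p, is_prime p /\ forall x, I x -> p x.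
Proof.
move: I; apply: noeth_ind => I hI IH h1.
have [pI|/(nonprime_split hI h1) [x [y [hx hy hxy]]]] := classic (is_prime I); first by exists I.
have sub z p : (forall x0, addI I (prinI z) x0 -> p x0) -> forall x0, I x0 -> p x0.
  by move=> h t It; apply: h; apply: addI_l => //; apply: prinI_ideal.
have [hx1|hx1] := classic (addI I (prinI x) 1); last first.
  have [p [pp hp]] := IH _ (addI_ideal hI (prinI_ideal x)) (strict_add hI hx) hx1.
  by exists p; split=> //; apply: (sub x).
have [hy1|hy1] := classic (addI I (prinI y) 1); last first.
  have [p [pp hp]] := IH _ (addI_ideal hI (prinI_ideal y)) (strict_add hI hy) hy1.
  by exists p; split=> //; apply: (sub y).
by case: h1; rewrite -(mulr1 1); apply: (add_prin_mul hI hxy).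
Qed.

(** The list contains all minimal primes over [I]. When [x * y] is in [I], a prime over [I] lies
    over [I + (x)] or over [I + (y)], so the two lists are joined. *)
Lemma finite_primes I : is_ideal I ->
  exists L : list (R -> Prop), (forall p, List.In p L -> is_prime p /\ forall x, I x -> p x) /\
    forall Q, is_prime Q -> (forall x, I x -> Q x) ->
      exists p, List.In p L /\ forall x, p x -> Q x.
Proof.
move: I; apply: noeth_ind => I hI IH.
have [h1|h1] := classic (I 1).
  exists nil; split=> // Q [_ [hQ _]] h; by case: hQ; apply: h.
have [pI|/(nonprime_split hI h1) [x [y [hx hy hxy]]]] := classic (is_prime I).
  by exists [:: I]; split=> [p [<-|//]|Q pQ h] //; exists I; split=> //; left.
have [L1 [h1L h1Q]] := IH _ (addI_ideal hI (prinI_ideal x)) (strict_add hI hx).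
have [L2 [h2L h2Q]] := IH _ (addI_ideal hI (prinI_ideal y)) (strict_add hI hy).
have sub z p : (forall x0, addI I (prinI z) x0 -> p x0) -> forall x0, I x0 -> p x0.
  by move=> h t It; apply: h; apply: addI_l => //; apply: prinI_ideal.
exists (L1 ++ L2)%list; split.
  move=> p /List.in_app_iff [/h1L|/h2L] [pp hp]; split=> //; [exact: (sub x)|exact: (sub y)].
move=> Q pQ hQ.
have sub' z : Q z -> forall x0, addI I (prinI z) x0 -> Q x0.
  move=> Qz t [u [v [Iu [[c ->] ->]]]]; have hQi := prime_ideal pQ.
  by apply: idealD => //; [apply: hQ | apply: ideal_mull].
case: (proj2 (proj2 pQ) _ _ (hQ _ hxy)) => [/sub' h|/sub' h].
  by have [p [hp hpQ]] := h1Q Q pQ h; exists p; split=> //; apply/List.in_app_iff; left.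
by have [p [hp hpQ]] := h2Q Q pQ h; exists p; split=> //; apply/List.in_app_iff; right.
Qed.

End Noetherian.


(** * Polynomial rings *)

Lemma exists_argmin (T : Type) (m : T -> nat) (P : T -> Prop) x :
  P x -> exists y, P y /\ forall z, P z -> (m y <= m z)%N.
Proof.
have [k] := ubnP (m x); elim: k x => // k IH x hk Px.
have [h|h] := classic (exists z, P z /\ (m z < m x)%N).
  by have [z [Pz hz]] := h; apply: (IH z) => //; apply: leq_trans hz _.
exists x; split=> // z Pz; rewrite leqNgt; apply/negP => hz; apply: h; by exists z.
Qed.

Lemma span_cat_sub (R : comNzRingType) (a : seq R) k x :
  Defs.span (take k a) x -> Defs.span a x.
Proof.
apply: span_sub; first exact: span_ideal.
move=> i hi; have h2 : (i < size a)%N by apply: leq_trans hi _; rewrite size_take_min geq_minr.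
rewrite nth_take; first exact: span_nth.
by move: hi; rewrite size_take_min leq_min => /andP [].
Qed.

Section Poly.
Variable A : comNzRingType.
Hypothesis An : noetherian A.
Implicit Types q : A -> Prop.

(** Hilbert's basis theorem. Each [f n] has least size in [I] outside the span of its predecessors.
    Once the ideals of leading coefficients stop growing, the combination [s] of earlier terms
    cancels the leading term of [f n], against minimality. *)
Lemma noetherian_poly : noetherian {poly A}.
Proof.
move=> I hI; apply: NNPP => nfg.
pose good a f := [/\ I f, ~ Defs.span a f &
  forall g, I g -> ~ Defs.span a g -> (size f <= size g)%N].
pose nextf a : {poly A} := epsilon (inhabits 0) (good a).
pose F n := iter n (fun a => rcons a (nextf a)) [::].
pose f n := nextf (F n).
have FE n : F n = mkseq f n by elim: n => // n IH; rewrite mkseqS -IH.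
have goodf n : (forall i, (i < n)%N -> I (f i)) -> good (F n) (f n).
  move=> hn; apply: (epsilon_spec (inhabits 0) (good (F n))).
  have [g [Ig ng]] : exists g, I g /\ ~ Defs.span (F n) g.
    apply: NNPP => h; apply: nfg; exists (F n) => g; split=> [Ig|].
      by apply: NNPP => ng; apply: h; exists g.
    apply: span_sub => // i; rewrite FE size_mkseq => hi; rewrite nth_mkseq //; exact: hn.
  have [y [[Iy ny] hy]] := @exists_argmin _ (fun p : {poly A} => size p)
     (fun g => I g /\ ~ Defs.span (F n) g) g (conj Ig ng).
  by exists y; split=> // z Iz nz; apply: hy.
have If n : I (f n).
  by have [m] := ubnP n; elim: m n => // m IH n hn; case: (goodf n) => // i hi; apply: IH; lia.
have gf n : good (F n) (f n) by apply: goodf.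
have sizef i n : (i <= n)%N -> (size (f i) <= size (f n))%N.
  move=> hin; have [_ _ hi] := gf i; apply: hi => // hs; have [_ hn _] := gf n; apply: hn.
  apply: (@span_cat_sub _ (F n) i).
  by move: hs; rewrite !FE -map_take take_iota (minn_idPl hin).
pose L n := Defs.span (mkseq (fun i => lead_coef (f i)) n).
have [n hn] : exists n, forall x, L n.+1 x -> L n x.
  apply: noeth_ascending => // [n|n x]; first exact: span_ideal.
  rewrite /L mkseqS => h; apply: (@span_cat_sub _ _ n).
  by rewrite -cats1 take_size_cat ?size_mkseq.
have [b [_ hb]] : L n (lead_coef (f n)).
  apply: hn; have := @span_nth _ (mkseq (fun i => lead_coef (f i)) n.+1) n.
  by rewrite size_mkseq nth_mkseq //; apply.
rewrite size_mkseq in hb.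
pose s : {poly A} := \sum_(i < n) (b`_i *: 'X^(size (f n) - size (f i))) * f i.
have [_ nspan minf] := gf n.
have hs : Defs.span (F n) s.
  apply: ideal_sum; first exact: span_ideal.
  move=> i _; apply: ideal_mull; first exact: span_ideal.
  by have := @span_nth _ (F n) i; rewrite FE size_mkseq nth_mkseq //; apply.
have Is : I s by apply: ideal_sum => // i _; apply: ideal_mull.
have fn0 : f n != 0.
  by apply/eqP => h; apply: nspan; rewrite h; apply: ideal0; apply: span_ideal.
have: (size (f n) <= size (f n - s)%R)%N.
  apply: minf; first exact: idealB.
  by move=> h; apply: nspan; apply: (ideal_eq_sub (span_ideal _) h).
apply/negP; rewrite -ltnNge.
have f0 : (0 < size (f n))%N by rewrite size_poly_gt0.
rewrite -[X in (_ < X)%N](prednK f0) ltnS; apply/leq_sizeP => j.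
rewrite leq_eqVlt => /orP [/eqP <-|hj].
  rewrite coefB -lead_coefE hb coef_sum -sumrB big1 // => i _.
  have hi := sizef i n (ltnW (ltn_ord i)).
  rewrite nth_mkseq // -scalerAl coefZ coefXnM.
  have fi0 : (0 < size (f i))%N.
    rewrite size_poly_gt0; apply/eqP => h; have [_ h2 _] := gf i; apply: h2; rewrite h.
    by apply: ideal0; apply: span_ideal.
  have -> : ((size (f n)).-1 < size (f n) - size (f i))%N = false by lia.
  have -> : ((size (f n)).-1 - (size (f n) - size (f i)))%N = (size (f i)).-1 by lia.
  by rewrite -lead_coefE subrr.
have hj' : (size (f n) <= j)%N by lia.
rewrite coefB (nth_default _ hj') coef_sum big1 ?subr0 // => i _.
have hi := sizef i n (ltnW (ltn_ord i)).
rewrite -scalerAl coefZ coefXnM.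
have -> : (j < size (f n) - size (f i))%N = false by lia.
by rewrite [(f i)`__]nth_default ?mulr0 // -[X in (X <= _)%N](subKn hi) leq_sub2r.
Qed.

Definition extI (q : A -> Prop) (g : {poly A}) : Prop := forall i, q g`_i.
Definition contr (Q : {poly A} -> Prop) (c : A) : Prop := Q c%:P.

Lemma extI_ideal q : is_ideal q -> is_ideal (extI q).
Proof.
move=> hq; split; last split.
- by move=> i; rewrite coef0; apply: ideal0.
- by move=> f g hf hg i; rewrite coefD; apply: idealD.
- by move=> f g hg i; rewrite coefM; apply: ideal_sum => // j _; apply: ideal_mull.
Qed.

Lemma extI_sub (Q : {poly A} -> Prop) q : is_ideal Q -> (forall c, q c -> Q c%:P) ->
  forall g, extI q g -> Q g.
Proof.
move=> hQ h g hg; rewrite -[g]coefK poly_def; apply: ideal_sum => // i _.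
by rewrite -mul_polyC; apply: (ideal_mulr _ hQ); apply: h.
Qed.

Lemma extI_poly q c : is_ideal q -> q c -> extI q c%:P.
Proof. by move=> hq qc i; rewrite coefC; case: eqP => // _; apply: ideal0. Qed.

Lemma contr_prime Q : is_prime Q -> is_prime (contr Q).
Proof.
move=> [hQ [h1 hM]]; split; last split.
- split; last split; rewrite /contr.
  + by rewrite polyC0; apply: ideal0.
  + by move=> x y hx hy; rewrite polyCD; apply: idealD.
  + by move=> a x hx; rewrite polyCM; apply: ideal_mull.
- by rewrite /contr polyC1.
- by move=> x y; rewrite /contr polyCM => /hM.
Qed.

Lemma extI_prime q : is_prime q -> is_prime (extI q).
Proof.
move=> [hq [h1 hM]]; split; first exact: extI_ideal.
split; first by move/(_ 0%N); rewrite coef1.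
move=> f g hfg; apply: NNPP => /not_or_and [hf hg].
(* With lowest coefficients outside [q] at [i] and [j], every other summand of coefficient [i + j]
   of the product lies in [q]. *)
have least (p : {poly A}) : ~ extI q p ->
    exists i, ~ q p`_i /\ forall j, (j < i)%N -> q p`_j.
  move=> hp; have [i hi] : exists i, ~ q p`_i.
    by apply: NNPP => h; apply: hp => i; apply: NNPP => hi; apply: h; exists i.
  have [y [ny hy]] := @exists_argmin _ id (fun i => ~ q p`_i) i hi.
  exists y; split=> // j hj; apply: NNPP => nj; have := hy _ nj; lia.
have [i [ni hi]] := least f hf; have [j [nj hj]] := least g hg.
have := hfg (i + j)%N; rewrite coefM.
have hi' : (i < (i + j).+1)%N by lia.
rewrite (bigD1 (Ordinal hi')) //= addKn => h.
have: q (f`_i * g`_j).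
  rewrite -[_ * _](addrK (\sum_(k < (i + j).+1 | k != Ordinal hi') f`_k * g`_(i + j - k))).
  apply: idealB => //; apply: ideal_sum => // k hk.
  have [hki|hki] := ltnP k i; first by apply: ideal_mulr => //; apply: hi.
  apply: ideal_mull => //; apply: hj.
  have : nat_of_ord k <> i by move=> e; case/eqP: hk; apply: val_inj.
  have := ltn_ord k; lia.
by case/hM.
Qed.

Lemma size_sub_lead (h : {poly A}) : h != 0 ->
  (size (h - lead_coef h *: 'X^((size h).-1))%R < size h)%N.
Proof.
move=> h0; have hs : (0 < size h)%N by rewrite size_poly_gt0.
rewrite -[X in (_ < X)%N](prednK hs) ltnS; apply/leq_sizeP => j.
rewrite coefB coefZ coefXn leq_eqVlt => /orP [/eqP <-|hj].
  by rewrite eqxx mulr1 -lead_coefE subrr.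
rewrite nth_default; last by rewrite -(prednK hs).
by rewrite (gtn_eqF hj) mulr0 subr0.
Qed.

(* Over the fraction field of [A/q] the nonzero primes of the polynomial ring are maximal;
   pseudo-division makes this elementary. *)
Lemma contr_chain (P Q : {poly A} -> Prop) : is_prime P -> is_prime Q ->
  strict_sub P Q -> (forall c, contr Q c -> contr P c) ->
  forall g, P g -> extI (contr P) g.
Proof.
move=> pP pQ [hPQ [h1 [Qh1 nPh1]]] hc g1 Pg1; apply: NNPP => ng1.
have iP := prime_ideal pP; have iQ := prime_ideal pQ; have pq := contr_prime pP.
have iq := extI_ideal (prime_ideal pq).
have hxq c (n : nat) : contr P c -> P (c *: 'X^n).
  by move=> hcP; rewrite -mul_polyC; apply: ideal_mulr.
have hxe c (n : nat) : contr P c -> extI (contr P) (c *: 'X^n).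
  move=> hcP; rewrite -mul_polyC; apply: (ideal_mulr _ iq).
  exact: (extI_poly (prime_ideal pq)).
(* [h] has least size in [Q] outside [P], and [g] has least size among the elements of [P] with a
   coefficient outside [P]. Minimality keeps both leading coefficients outside [P]. *)
have [h [[Qh nPh] hmin]] := @exists_argmin _ (fun p : {poly A} => size p)
   (fun h => Q h /\ ~ P h) h1 (conj Qh1 nPh1).
have [g [[Pg ng] gmin]] := @exists_argmin _ (fun p : {poly A} => size p)
   (fun g => P g /\ ~ extI (contr P) g) g1 (conj Pg1 ng1).
have h0 : h != 0 by apply/eqP => e; apply: nPh; rewrite e; exact: ideal0.
have g0 : g != 0.
  by apply/eqP => e; apply: ng; rewrite e; exact: (ideal0 iq).
have lh : ~ P (lead_coef h)%:P.
  move=> hl; have := size_sub_lead h0; rewrite ltnNge => /negP; apply; apply: hmin; split.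
    by apply: idealB => //; apply/hPQ/hxq.
  by move=> hh; apply: nPh; apply: (ideal_eq_sub iP hh); apply: hxq.
have lg : ~ P (lead_coef g)%:P.
  move=> hl; have := size_sub_lead g0; rewrite ltnNge => /negP; apply; apply: gmin; split.
    by apply: idealB => //; apply: hxq.
  move=> hh; apply: ng; apply: (ideal_eq_sub iq hh); exact: hxe.
have powP c k : ~ P c%:P -> ~ P (c ^+ k)%:P.
  by move=> nc; elim: k => [|k IH]; [exact: pP.2.1 | rewrite exprS polyCM; apply: prime_mulN].
have hdiv (u v : {poly A}) : v != 0 -> exists k (d r : {poly A}),
   (size r < size v)%N /\ u * (lead_coef v ^+ k)%:P = d * v + r.
  move=> v0; exists (Pdiv.Ring.rscalp u v), (Pdiv.Ring.rdivp u v), (Pdiv.Ring.rmodp u v).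
  by rewrite Pdiv.Ring.ltn_rmodp v0 mulrC mul_polyC Pdiv.ComRing.rdivp_eq.
(* The larger one is divided by the smaller. If [h] is divided by [g], the remainder is in [P] by
   minimality of [h], and then so is [h], a contradiction. *)
have [hsz|hsz] := leqP (size g) (size h).
  have [k [d [r [hr e]]]] := hdiv h g g0.
  have Pr : P r.
    apply: NNPP => nr; have := hmin r; rewrite leqNgt (leq_trans hr hsz) => hh.
    suff: false by []; apply: hh; split=> //.
    have -> : r = h * (lead_coef g ^+ k)%:P - d * g by rewrite e addrC addKr.
    by apply: idealB => //; [apply: ideal_mulr | apply: hPQ; apply: ideal_mull].
  apply: (prime_mulN pP nPh (powP _ k lg)); rewrite e; apply: idealD => //; exact: ideal_mull.
have [k [d [r [hr e]]]] := hdiv g h h0.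
have Pr : P r.
  apply: NNPP => nr; have := hmin r; rewrite leqNgt hr => hh.
  suff: false by []; apply: hh; split=> //.
  have -> : r = g * (lead_coef h ^+ k)%:P - d * h by rewrite e addrC addKr.
  by apply: idealB => //; [apply: ideal_mulr=> //; apply: hPQ | apply: ideal_mull].
have er : extI (contr P) r.
  by apply: NNPP => nr; have := gmin r (conj Pr nr); lia.
have Pd : P d.
  have: P (d * h) by rewrite -(addrK r (d * h)) -e; apply: idealB => //; apply: ideal_mulr.
  by case/(pP.2.2).
(* A constant [h] would lie in the contraction of [Q], hence in [P] by [hc]. *)
have hs2 : (1 < size h)%N.
  rewrite ltnNge; apply/negP => /size1_polyC hC; apply: nPh; rewrite hC; apply: hc.
  by rewrite /contr -hC.
have ed : extI (contr P) d.
  apply: NNPP => nd.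
  have [d' [hd' dmin]] := @exists_argmin _ (fun p : {poly A} => size p)
    (fun p => extI (contr P) (d - p)) d (eq_ind_r _ (ideal0 iq) (subrr d)).
  have nd' : ~ extI (contr P) d' by move=> h'; apply: nd; apply: (ideal_eq_sub iq hd').
  have Pd' : P d'.
    rewrite -(subKr d d'); apply: idealB => //.
    exact: (extI_sub iP (fun c hc => hc) hd').
  have d0 : d' != 0 by apply/eqP => e0; apply: nd'; rewrite e0; apply: ideal0.
  have ld : ~ contr P (lead_coef d').
    move=> hl; have := size_sub_lead d0; rewrite ltnNge => /negP; apply; apply: dmin.
    by rewrite opprB addrCA; apply: (idealD iq _ hd'); apply: hxe.
  have hgd := gmin d' (conj Pd' nd').
  apply: (prime_mulN pq ld lh); rewrite mul_lead_coef.
  have szd : (0 < size d')%N by rewrite size_poly_gt0.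
  (* [d'] is at least as large as [g] and [h] is not constant, so the top coefficient of [d' * h]
     sits beyond [g] and [r]; the product of the two leading coefficients would lie in [P]. *)
  have : extI (contr P) (d' * h - (d * h + r - r)).
    by rewrite addrK -mulrBl -opprB mulNr; apply: (idealN iq); apply: (ideal_mulr _ iq).
  move/(_ (size d' + size h).-2); rewrite -e coefB coefB coefMC.
  have aux a b c : (a <= b -> 1 < c -> a <= (b + c).-2)%N by lia.
  have aux' a b c : (0 < a -> b < c -> b <= (a + c).-2)%N by lia.
  rewrite [g`__]nth_default; last exact: (aux _ _ _ hgd hs2).
  by rewrite [r`__]nth_default ?mul0r ?subr0 //; exact: (aux' _ _ _ szd hr).
have := extI_prime pq => -[_ [_ /(_ g (lead_coef h ^+ k)%:P)]]; case=> //.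
  by rewrite e; apply: (idealD iq) => //; apply: (ideal_mulr _ iq).
by move/(_ 0%N); rewrite coefC; apply: powP.
Qed.
End Poly.


(** * Residue fields *)

Section Residue.
Variables (R : comNzRingType) (p : R -> Prop) (pp : is_prime p).

(** Membership is decided classically because the quotient construction takes a boolean predicate;
    the primality proof is an argument so that the prime ideal structure can be attached to the
    predicate. *)
Definition res_mem (_ : is_prime p) : pred R := fun x => excluded_middle_informative (p x).

Lemma res_memP x : reflect (p x) (x \in res_mem pp).
Proof. by rewrite unfold_in /res_mem; case: excluded_middle_informative => h; constructor. Qed.

Fact res_mem_idealr : idealr_closed (res_mem pp).
Proof.
have hp := prime_ideal pp; split.
- by apply/res_memP; apply: ideal0.
- by apply/res_memP; exact: pp.2.1.
- move=> a x y /res_memP hx /res_memP hy; apply/res_memP; apply: (idealD hp) => //; exact: ideal_mull.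
Qed.
HB.instance Definition _ := isIdealr.Build R (res_mem pp) res_mem_idealr.

Fact res_mem_prime : prime_idealr_closed (res_mem pp).
Proof. by move=> u v /res_memP /(pp.2.2) [h|h]; apply/orP; [left|right]; apply/res_memP. Qed.
HB.instance Definition _ := isPrimeIdealrClosed.Build R (res_mem pp) res_mem_prime.

Definition res_idealr : prime_idealr R := res_mem pp.
Definition res_quo := {ideal_quot res_idealr}.
HB.instance Definition _ := GRing.ComNzRing.on res_quo.

(** The fraction field is formed over integral domains that carry units and inverses; both are
    supplied by choice. *)
Definition res_unit : pred res_quo := fun x => excluded_middle_informative (exists y, y * x = 1).
Definition res_inv (x : res_quo) : res_quo :=
  if excluded_middle_informative (exists y, y * x = 1) is left h then
    sval (constructive_indefinite_description _ h) else x.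

Fact res_mulVx : {in res_unit, left_inverse 1 res_inv *%R}.
Proof.
move=> x; rewrite unfold_in /res_unit /res_inv; case: excluded_middle_informative => //= h _.
exact: svalP (constructive_indefinite_description _ h).
Qed.
Fact res_unitPl (x y : res_quo) : y * x = 1 -> res_unit x.
Proof. by move=> h; rewrite /res_unit; case: excluded_middle_informative => // -[]; exists y. Qed.
Fact res_inv_out : {in [predC res_unit], res_inv =1 id}.
Proof. by move=> x; rewrite inE unfold_in /res_unit /res_inv; case: excluded_middle_informative. Qed.
HB.instance Definition _ := GRing.ComNzRing_hasMulInverse.Build res_quo res_mulVx res_unitPl res_inv_out.

Fact res_integral : GRing.integral_domain_axiom res_quo.
Proof. exact: Quotient.rquot_IdomainAxiom. Qed.
HB.instance Definition _ := GRing.ComUnitRing_isIntegral.Build res_quo res_integral.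

Definition res_pi (x : R) : res_quo := \pi_res_quo%qT x.
Fact res_pi_zmod : zmod_morphism res_pi. Proof. exact: (raddfB (\pi_res_quo)%qT). Qed.
Fact res_pi_mon : monoid_morphism res_pi.
Proof. by split; [exact: (rmorph1 (\pi_res_quo)%qT) | exact: (rmorphM (\pi_res_quo)%qT)]. Qed.
HB.instance Definition _ := GRing.isZmodMorphism.Build R res_quo res_pi res_pi_zmod.
HB.instance Definition _ := GRing.isMonoidMorphism.Build R res_quo res_pi res_pi_mon.

Lemma res_pi_eq0 x : p x <-> res_pi x = 0.
Proof.
rewrite -(rmorph0 res_pi); split => [/res_memP|/eqP] h.
  by apply/eqP; rewrite /res_pi -Quotient.idealrBE subr0.
by move: h; rewrite /res_pi -Quotient.idealrBE subr0 => /res_memP.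
Qed.

Definition residue (x : R) : {fraction res_quo} := FracField.tofrac (res_pi x).

Fact residue_zmod : zmod_morphism residue.
Proof. by move=> x y; rewrite /residue !rmorphB. Qed.
Fact residue_mon : monoid_morphism residue.
Proof. by split=> [|x y]; rewrite /residue ?rmorph1 // !rmorphM. Qed.
HB.instance Definition _ := GRing.isZmodMorphism.Build R {fraction res_quo} residue residue_zmod.
HB.instance Definition _ := GRing.isMonoidMorphism.Build R {fraction res_quo} residue residue_mon.

Lemma residue_eq0 x : p x <-> residue x = 0.
Proof.
by rewrite res_pi_eq0 /residue; split=> [->|/eqP]; rewrite ?tofrac0 // tofrac_eq0 => /eqP.
Qed.
End Residue.


Definition rker (R : comNzRingType) (K : fieldType) (f : {rmorphism R -> K}) (x : R) : Prop :=
  f x = 0.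

Lemma rker_prime (R : comNzRingType) (K : fieldType) (f : {rmorphism R -> K}) : is_prime (rker f).
Proof.
rewrite /rker; split; last split.
- split; first by rewrite rmorph0.
  split=> [x y hx hy|a x hx]; first by rewrite rmorphD hx hy addr0.
  by rewrite rmorphM hx mulr0.
- by rewrite rmorph1; apply/eqP; rewrite oner_eq0.
- by move=> x y /eqP; rewrite rmorphM mulf_eq0 => /orP [/eqP|/eqP]; [left|right].
Qed.

(** Through this, statements at a prime become rank statements over a field, without
    localization. *)
Lemma residue_field (R : comNzRingType) (p : R -> Prop) : is_prime p ->
  exists (K : fieldType) (f : {rmorphism R -> K}), rker f = p.
Proof.
move=> pp; exists {fraction (res_quo pp)}, (@residue _ _ pp).
by apply: pred_ext => x; rewrite /rker (residue_eq0 pp).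
Qed.

(** * Ranks over residue fields, read off from minors *)

Section Minors.
Variable K : fieldType.

Lemma minor_neq0 N m (X : 'M[K]_(N, m)) :
  exists (f : 'I_(\rank X) -> 'I_N) (g : 'I_(\rank X) -> 'I_m), \det (mxsub f g X) != 0.
Proof.
have hB := maxrowsub_free X; set f := maxrankfun X in hB.
have hBt : row_full (rowsub f X)^T by rewrite /row_full mxrank_tr.
exists f, (fullrankfun hBt).
have := fullrowsub_unit hBt; rewrite -unitmx_tr unitmxE unitfE.
by congr (\det _ != 0); apply/matrixP => i j; rewrite !mxE.
Qed.

Lemma minor_rank N m s (X : 'M[K]_(N, m)) (f : 'I_s -> 'I_N) (g : 'I_s -> 'I_m) :
  \det (mxsub f g X) != 0 -> (s <= \rank X)%N.
Proof.
move=> h; have: mxsub f g X \in unitmx by rewrite unitmxE unitfE.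
rewrite -row_free_unit => /eqP <-.
have -> : mxsub f g X = rowsub f 1%:M *m X *m colsub g 1%:M.
  by rewrite -mulmxA -rowsubE mulmx_colsub mulmx1 -mxsub_comp.
apply: leq_trans (mxrankM_maxl _ _) (mxrankM_maxr _ _).
Qed.
End Minors.

(** A minor that survives in [K'] is not killed by [f] either, so the rank can only drop under
    specialization. *)
Lemma rank_spec (R : comNzRingType) (K K' : fieldType) (f : {rmorphism R -> K})
    (f' : {rmorphism R -> K'}) N m (X : 'M[R]_(N, m)) :
  (forall x, f x = 0 -> f' x = 0) -> (\rank (map_mx f' X) <= \rank (map_mx f X))%N.
Proof.
move=> hk; have [g [h]] := minor_neq0 (map_mx f' X).
rewrite -map_mxsub det_map_mx => hd; apply: (@minor_rank _ _ _ _ _ g h).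
by rewrite -map_mxsub det_map_mx; apply: contra hd => /eqP /hk ->.
Qed.

(** * General position *)

Lemma col_mx_subl (K : fieldType) m1 m2 n (A : 'M[K]_(m1, n)) (B : 'M[K]_(m2, n)) :
  (A <= col_mx A B)%MS.
Proof. by have := submx_refl (col_mx A B); rewrite col_mx_sub => /andP []. Qed.

Lemma col_mx_subr (K : fieldType) m1 m2 n (A : 'M[K]_(m1, n)) (B : 'M[K]_(m2, n)) :
  (B <= col_mx A B)%MS.
Proof. by have := submx_refl (col_mx A B); rewrite col_mx_sub => /andP []. Qed.

Section EisenbudEvans.
Variables (R : comNzRingType).

(* [D t p] stands for "the dimension function is at least [t] at [p]": on a closed set where this
   holds, the value exceeds [t] outside the finitely many generic points. *)
Definition dimp (D : nat -> (R -> Prop) -> Prop) : Prop :=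
  (forall p, is_prime p -> D 0%N p) /\
  forall t Z a, is_ideal Z ->
    (forall Q, is_prime Q -> (forall x, Z x -> Q x) -> ~ Q a -> D t Q) ->
    exists L : list (R -> Prop), (forall p, List.In p L -> is_prime p) /\
      forall Q, is_prime Q -> (forall x, Z x -> Q x) -> ~ Q a -> List.In Q L \/ D t.+1 Q.

Lemma list_minimal (T : Type) (L : list (T -> Prop)) : L <> nil ->
  exists p, List.In p L /\ forall q, List.In q L -> (forall x, q x -> p x) -> q = p.
Proof.
elim: L => // p0 L IH _; have [->|/IH [p [pL hp]]] := classic (L = nil).
  by exists p0; split; [left | move=> q [<-|[]]].
have [h|h] := classic (forall x, p0 x -> p x).
  exists p0; split; first by left.
  move=> q [->//|qL] hq; have e := hp q qL (fun x qx => h x (hq x qx)); subst q.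
  by apply: pred_ext => x; split; auto.
exists p; split; first by right.
by move=> q [<-|qL] hq; [case: h | apply: hp].
Qed.

Lemma list_del (T : Type) (p : T) (L : list T) : List.In p L ->
  exists L', (size L' < size L)%N /\ forall q, List.In q L' <-> List.In q L /\ q <> p.
Proof.
elim: L => // x L IH hp.
have [hpL|hpL] := classic (List.In p L).
  have [L' [hs h]] := IH hpL; have [e|ne] := classic (x = p).
    exists L'; split; first by apply: (leq_trans hs).
    move=> q; rewrite h /=; split=> [[hq nq]|[[e'|hq] nq]]; auto.
    by case: nq; rewrite -e' e.
  exists (x :: L'); split=> // q /=; rewrite h; split=> [[<-|[? ?]]|[[?|?] ?]]; auto.
exists L; split=> // q /=; case: hp => // e; split=> [hq|[[e'|hq] nq]]; auto.
  by split; [right | move=> e'; apply: hpL; rewrite -e'].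
by case: nq; rewrite -e' e.
Qed.

(** The product of one element from each [q] outside [p] stays outside [p]. *)
Lemma prime_avoid (p : R -> Prop) (L : list (R -> Prop)) : is_prime p ->
  (forall q, List.In q L -> is_prime q /\ ~ (forall x, q x -> p x)) ->
  exists b, ~ p b /\ forall q, List.In q L -> q b.
Proof.
move=> pp; elim: L => [_|q L IH h]; first by exists 1; split=> //; exact: pp.2.1.
have [b [nb hb]] := IH (fun q' hq' => h q' (or_intror hq')).
have [pq /not_all_ex_not [c hc]] := h q (or_introl erefl).
have [qc nc] := imply_to_and _ _ hc.
exists (c * b); split; first exact: prime_mulN.
move=> q' [<-|hq']; first exact: (ideal_mulr _ (prime_ideal pq)).
by apply: (ideal_mull _ (prime_ideal (h q' (or_intror hq')).1)); apply: hb.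
Qed.

(* One prime at a time, a prime minimal in the list being treated last: a correction [b] lying in
   the other primes but not in this one leaves them undisturbed. If [x] kills the rows of [W] at
   [p], then adding a multiple of [v] to a row [i] with [x i <> 0] puts [v] into the row space. *)
Lemma absorb_row N m (W : 'M[R]_(N, m)) (v : 'rV[R]_m) (a : R) (L : list (R -> Prop)) :
  (forall p, List.In p L -> is_prime p) ->
  exists c : 'cV[R]_N, forall (K : fieldType) (f : {rmorphism R -> K}),
    List.In (rker f) L -> f a != 0 ->
    (\rank (map_mx f (col_mx W v)) <= N)%N ->
    (\rank (map_mx f (col_mx W v)) <= \rank (map_mx f (W + a *: (c *m v))))%N.
Proof.
have [k] := ubnP (size L); elim: k L => // k IH L hk hL.
have [->|nL] := classic (L = nil); first by exists 0.
have [p [pL pmin]] := list_minimal nL.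
have [L' [hs hL']] := list_del pL.
have pp := hL p pL.
have [c hc] := IH L' (leq_trans hs hk) (fun q hq => hL q ((hL' q).1 hq).1).
have [K0 [f0 ef0]] := residue_field pp.
set X := col_mx W v.
(* Ranks depend on [f] only through its kernel, so it is enough to treat the one field [K0] at
   [p]. *)
have hp c' : (f0 a != 0 -> (\rank (map_mx f0 X) <= N)%N ->
      (\rank (map_mx f0 X) <= \rank (map_mx f0 (W + a *: (c' *m v))))%N) ->
    forall (K : fieldType) (f : {rmorphism R -> K}), rker f = p -> f a != 0 ->
    (\rank (map_mx f X) <= N)%N ->
    (\rank (map_mx f X) <= \rank (map_mx f (W + a *: (c' *m v))))%N.
  move=> h0 K f ef fa.
  have e1 x : f x = 0 <-> f0 x = 0 by rewrite -/(rker f x) -/(rker f0 x) ef ef0.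
  have er M (Y : 'M_(M, m)) : \rank (map_mx f Y) = \rank (map_mx f0 Y).
    by apply/eqP; rewrite eqn_leq !rank_spec // => x /e1.
  rewrite !er; apply: h0; apply: contra fa => /eqP h; apply/eqP/e1; exact: h.
have [bad|good] := classic (f0 a != 0 /\ (\rank (map_mx f0 X) <= N)%N /\
   ~~ (\rank (map_mx f0 X) <= \rank (map_mx f0 (W + a *: (c *m v))))%N); last first.
  exists c => K f fL; have [e|ne] := classic (rker f = p); last first.
    by apply: hc; apply/hL'.
  apply: hp e => fa hr; apply/negP => hr2; apply: good; split=> //; split=> //; exact/negP.
have [fa [hr]] := bad; rewrite -ltnNge => hr2.
set W1 := W + _ in hr2.
have [b [nb hb]] : exists b, ~ p b /\ forall q, List.In q L' -> q b.
  apply: prime_avoid => // q /hL' [qL nq]; split; first exact: hL.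
  by move=> h; apply: nq; apply: pmin.
(* In the bad case the rank of [W1] is below that of [X], hence below the number [N] of its rows. *)
have [x xn0 hx] : exists2 x : 'rV[K0]_N, x != 0 & x *m map_mx f0 W1 = 0.
  have: kermx (map_mx f0 W1) != 0.
    rewrite kermx_eq0 -row_leq_rank -ltnNge; exact: leq_trans hr2 hr.
  by case/rowV0Pn => x /sub_kermxP hx xn0; exists x.
have [i xi] : exists i, x 0 i != 0.
  apply/existsP; apply: contraNT xn0; rewrite negb_exists => /forallP h.
  by apply/eqP/rowP => i; rewrite mxE; apply/eqP; have := h i; rewrite negbK.
exists (c + b *: delta_mx i 0).
have eW2 : W + a *: ((c + b *: delta_mx i 0) *m v) = W1 + (a * b) *: (delta_mx i 0 *m v).
  by rewrite mulmxDl scalerDr addrA -scalemxAl scalerA.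
move=> K f fL; have [e|ne] := classic (rker f = p); last first.
  have fL' : List.In (rker f) L' by apply/hL'.
  rewrite eW2 map_mxD; have -> : map_mx f ((a * b) *: (delta_mx i 0 *m v)) = 0.
    by rewrite map_mxZ rmorphM (hb _ fL') mulr0 scale0r.
  by rewrite addr0; apply: hc.
apply: hp e => _ _; rewrite eW2.
set W2 := W1 + _.
have fb : f0 b != 0 by apply/eqP => h; apply: nb; rewrite -ef0.
have hv : (map_mx f0 v <= map_mx f0 W2)%MS.
  have e2 : x *m map_mx f0 W2 = (x 0 i * f0 (a * b)) *: map_mx f0 v.
    rewrite map_mxD mulmxDr hx add0r map_mxZ map_mxM map_delta_mx -scalemxAr mulmxA.
    by rewrite -colE [col i x]mx11_scalar !mxE mul_scalar_mx scalerA mulrC.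
  have n0 : x 0 i * f0 (a * b) != 0 by rewrite rmorphM !mulf_neq0.
  by rewrite -(scalerK n0 (map_mx f0 v)) -e2 scalemx_sub // submxMl.
apply: mxrankS; rewrite map_col_mx col_mx_sub hv andbT.
have -> : W = W2 - a *: ((c + b *: delta_mx i 0) *m v) by rewrite /W2 -eW2 addrK.
rewrite map_mxB addmx_sub // eqmx_opp map_mxZ map_mxM scalemx_sub //.
by apply: submx_trans hv; apply: submxMl.
Qed.

(** Induction on the rows of [V]: the first row [v] is spread by a column [c] over the other rows
    and [u]. Where the new rows have rank at most [r], the old ones have rank at most [r + 1], and
    the hypothesis gives [D (n - r - 1)], one short. By [dimp] the deficit is confined to finitely
    many primes; there [absorb_row] keeps the rank from dropping, so the hypothesis applies with [r]
    itself. *)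
Theorem eisenbud_evans (D : nat -> (R -> Prop) -> Prop) l m n (a : R) (u : 'rV[R]_m)
    (V : 'M[R]_(l, m)) : dimp D ->
  (forall (K : fieldType) (f : {rmorphism R -> K}) r, f a != 0 -> (r <= l)%N ->
     (\rank (map_mx f (col_mx V u)) <= r)%N -> D (n - r)%N (rker f)) ->
  exists g : 'rV[R]_l, forall (K : fieldType) (f : {rmorphism R -> K}), f a != 0 ->
    map_mx f (u + a *: (g *m V)) = 0 -> D n (rker f).
Proof.
move=> [D0 hD]; elim: l u V => [|l IH] u V hV.
  exists 0 => K f fa; rewrite mul0mx scaler0 addr0 => h0.
  have := hV K f 0%N fa isT; rewrite subn0; apply.
  by rewrite flatmx0 map_col_mx h0 -[X in col_mx X _]/(map_mx f _) flatmx0 col_mx0 mxrank0.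
have [v [V' eV]] : exists (v : 'rV_m) (V' : 'M_(l, m)), V = col_mx v V'.
  by exists (usubmx (V : 'M_(1 + l, m))), (dsubmx (V : 'M_(1 + l, m))); rewrite vsubmxK.
subst V; set W : 'M_(l + 1, m) := col_mx V' u.
set X := col_mx (col_mx v V') u.
have eX (K : fieldType) (f : {rmorphism R -> K}) :
    \rank (map_mx f (col_mx W v)) = \rank (map_mx f X).
  rewrite !map_col_mx; apply/eqP; rewrite eqn_leq; apply/andP; split; apply: mxrankS;
    rewrite !col_mx_sub; apply/andP; split; try (apply/andP; split).
  - exact: submx_trans (col_mx_subr _ _) (col_mx_subl _ _).
  - exact: col_mx_subr.
  - exact: submx_trans (col_mx_subl _ _) (col_mx_subl _ _).
  - exact: col_mx_subr.
  - exact: submx_trans (col_mx_subl _ _) (col_mx_subl _ _).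
  - exact: submx_trans (col_mx_subr _ _) (col_mx_subl _ _).
have listr r : (r <= l)%N -> exists L : list (R -> Prop), (forall p, List.In p L -> is_prime p) /\
    forall (K : fieldType) (f : {rmorphism R -> K}), f a != 0 ->
    (\rank (map_mx f X) <= r.+1)%N -> List.In (rker f) L \/ D (n - r)%N (rker f).
  (* For [n <= r] the truncated difference asks only for [D 0], which holds at every prime. *)
  move=> rl; have [nr|rn] := leqP n r.
    exists nil; split=> // K f _ _; right.
    have -> : (n - r = 0)%N by lia.
    exact/D0/rker_prime.
  (* The vanishing ideal of the locus of rank at most [r + 1]. Larger minors belong to it, so every
     prime over [Z] satisfies the rank bound. *)
  pose Z x := forall (K : fieldType) (f : {rmorphism R -> K}), (\rank (map_mx f X) <= r.+1)%N -> f x = 0.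
  have Zi : is_ideal Z.
    split; last split; first by move=> K f _; rewrite rmorph0.
    - by move=> x y hx hy K f h; rewrite rmorphD hx // hy // addr0.
    - by move=> b x hx K f h; rewrite rmorphM hx // mulr0.
  have [|L [hL hLD]] := hD (n - r.+1)%N Z a Zi.
    move=> Q pQ ZQ nQa; have [K [f ef]] := residue_field pQ; subst Q.
    apply: (hV K f r.+1) => //; first exact/eqP.
    rewrite leqNgt; apply/negP => hr; have [g [h]] := minor_neq0 (map_mx f X).
    rewrite -map_mxsub det_map_mx => /eqP; apply; apply: ZQ => K' f' hr'.
    apply/eqP; apply/negPn/negP => hd; have h1 : (\rank (map_mx f X) <= \rank (map_mx f' X))%N.
      by apply: (@minor_rank _ _ _ _ _ g h); rewrite -map_mxsub det_map_mx.
    by have := leq_trans hr (leq_trans h1 hr'); rewrite ltnn.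
  exists L; split=> // K f fa hr; have e : (n - r = (n - r.+1).+1)%N by lia.
  rewrite e; apply: hLD; first exact: rker_prime.
    by move=> x Zx; apply: Zx.
  exact/eqP.
have [L [hL hLD]] : exists L : list (R -> Prop), (forall p, List.In p L -> is_prime p) /\
    forall r, (r <= l)%N -> forall (K : fieldType) (f : {rmorphism R -> K}), f a != 0 ->
    (\rank (map_mx f X) <= r.+1)%N -> List.In (rker f) L \/ D (n - r)%N (rker f).
  suff: forall k, (k <= l.+1)%N -> exists L : list (R -> Prop),
      (forall p, List.In p L -> is_prime p) /\
      forall r, (r < k)%N -> forall (K : fieldType) (f : {rmorphism R -> K}), f a != 0 ->
      (\rank (map_mx f X) <= r.+1)%N -> List.In (rker f) L \/ D (n - r)%N (rker f).
    by move/(_ _ (leqnn _)).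
  elim=> [_|k IHk hk]; first by exists nil.
  have [L1 [h1 h1']] := IHk (ltnW hk); have [L2 [h2 h2']] := listr k hk.
  exists (L1 ++ L2)%list; split; first by move=> p /List.in_app_iff [/h1|/h2].
  move=> r; rewrite ltnS leq_eqVlt => /orP [/eqP ->|hr] K f fa hX.
    by case: (h2' K f fa hX) => h; [left; apply/List.in_app_iff; right | right].
  by case: (h1' r hr K f fa hX) => h; [left; apply/List.in_app_iff; left | right].
have [c hc] := absorb_row W v a hL.
set c1 := usubmx c; set c0 := dsubmx c.
have eW : W + a *: (c *m v) = col_mx (V' + a *: (c1 *m v)) (u + a *: (c0 *m v)).
  by rewrite -[in LHS](vsubmxK c) mul_col_mx scale_col_mx add_col_mx.
have [|g hg] := IH (u + a *: (c0 *m v)) (V' + a *: (c1 *m v)).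
  move=> K f r fa rl; rewrite -eW => hr.
  have hX : (\rank (map_mx f X) <= r.+1)%N.
    rewrite -eX; have := mxrank_adds_leqif (map_mx f (W + a *: (c *m v))) (map_mx f v).
    move=> [hle _]; apply: leq_trans (leq_trans hle _); last first.
      by rewrite -(addn1 r); apply: leq_add => //; apply: rank_leq_row.
    apply: mxrankS; rewrite map_col_mx col_mx_sub addsmxSr andbT.
    rewrite -{1}(addrK (a *: (c *m v)) W) map_mxB addmx_sub ?addsmxSl // eqmx_opp map_mxZ.
    by rewrite scalemx_sub // map_mxM; apply: submx_trans (submxMl _ _) (addsmxSr _ _).
  case: (hLD r rl K f fa hX) => // fL; apply: (hV K f r fa) => //; first by lia.
  rewrite -/X -eX; apply: leq_trans hr; apply: hc => //.
  by rewrite eX; apply: leq_trans hX _; rewrite addn1 ltnS.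
(* Read off by collecting the multiples of [v] in [u + a c0 v + a g (V' + a c1 v)]. *)
exists (row_mx (c0 + a *: (g *m c1)) g : 'rV_(1 + l)) => K f fa h0; apply: (hg K f fa).
rewrite -[RHS]h0; congr (map_mx f _).
transitivity (u + a *: ((c0 + a *: (g *m c1)) *m v + g *m V')); last first.
  by congr (_ + _ *: _); rewrite -mul_row_col.
rewrite mulmxDl mulmxDr -!scalemxAl -!scalemxAr mulmxA !scalerDr !addrA.
by rewrite -!addrA; congr (_ + (_ + _)); rewrite addrC.
Qed.

End EisenbudEvans.


(** * Matrix model of the quadric *)

Definition dot (R : comNzRingType) m (f : 'rV[R]_m) (x : 'cV[R]_m) : R := (f *m x) 0 0.

Section Dot.
Variables (R : comNzRingType) (m : nat).
Implicit Types (f g : 'rV[R]_m) (x y : 'cV[R]_m).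

Lemma dotDl f g x : dot (f + g) x = dot f x + dot g x.
Proof. by rewrite /dot mulmxDl mxE. Qed.
Lemma dotDr f x y : dot f (x + y) = dot f x + dot f y.
Proof. by rewrite /dot mulmxDr mxE. Qed.
Lemma dotBl f g x : dot (f - g) x = dot f x - dot g x.
Proof. by rewrite /dot mulmxBl !mxE. Qed.
Lemma dotBr f x y : dot f (x - y) = dot f x - dot f y.
Proof. by rewrite /dot mulmxBr !mxE. Qed.
Lemma dotZl a f x : dot (a *: f) x = a * dot f x.
Proof. by rewrite /dot -scalemxAl mxE. Qed.
Lemma dotZr a f x : dot f (a *: x) = a * dot f x.
Proof. by rewrite /dot -scalemxAr mxE. Qed.
Lemma dot0l x : dot (0 : 'rV[R]_m) x = 0.
Proof. by rewrite /dot mul0mx mxE. Qed.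
Lemma dot0r f : dot f 0 = 0.
Proof. by rewrite /dot mulmx0 mxE. Qed.
Lemma dot_delta f j : dot f (delta_mx j 0) = f 0 j.
Proof. by rewrite /dot -colE mxE. Qed.
Lemma dotA f (E : 'M_m) x : dot (f *m E) x = dot f (E *m x).
Proof. by rewrite /dot mulmxA. Qed.

Lemma dot_ideal (I : R -> Prop) f x : is_ideal I -> (forall j, I (f 0 j)) -> I (dot f x).
Proof.
by move=> hI hf; rewrite /dot mxE; apply: ideal_sum => // j _; apply: ideal_mulr.
Qed.

Definition dotI f (a : R) : Prop := exists y, a = dot f y.
Lemma dotI_ideal f : is_ideal (dotI f).
Proof.
split; first by exists 0; rewrite dot0r.
split=> [_ _ [x ->] [y ->]|a _ [x ->]]; first by exists (x + y); rewrite dotDr.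
by exists (a *: x); rewrite dotZr.
Qed.
End Dot.

Lemma dot_map (R S : comNzRingType) (h : {rmorphism R -> S}) m (f : 'rV[R]_m) x :
  dot (map_mx h f) (map_mx h x) = h (dot f x).
Proof. by rewrite /dot -map_mxM mxE. Qed.

Definition qt (R : comNzRingType) m := ('rV[R]_m * 'cV[R]_m * R)%type.

(** The columns fixed by [E] are the elements of its image, the rows fixed by [E] the functionals on
    it. *)
Definition QE (R : comNzRingType) m (E : 'M[R]_m) (u : qt R m) : Prop :=
  [/\ u.1.1 *m E = u.1.1, E *m u.1.2 = u.1.2 & dot u.1.1 u.1.2 + u.2 * (u.2 - 1) = 0].

Definition Iu (R : comNzRingType) m (u : qt R m) (a : R) : Prop :=
  exists y z, a = dot u.1.1 y + z * u.2.

Definition mapq (R S : comNzRingType) (h : R -> S) m (u : qt R m) : qt S m :=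
  (map_mx h u.1.1, map_mx h u.1.2, h u.2).

Definition Gamq (R : comNzRingType) m (u : qt R m) : qt R m := (u.1.1, u.1.2, 1 - u.2).

(* Moves [Iu u] while keeping [Iu (Gamq u)] fixed. *)
Definition Nm (R : comNzRingType) m (h : 'rV[R]_m) (u : qt R m) : qt R m :=
  (u.1.1 + (1 - u.2) ^+ 2 *: h, (1 - dot h u.1.2) *: u.1.2,
   1 - (1 - u.2) * (1 - dot h u.1.2)).

(** The two congruences say that the functional of [w] induces the orientations of [u] and [v], so
    [w] represents their star product. *)
Definition Prodq (R : comNzRingType) m (E : 'M[R]_m) (u v w : qt R m) : Prop :=
  [/\ QE E w, Iu w = prodI (Iu u) (Iu v),
      (forall y, sqI (Iu u) (dot (w.1.1 - u.1.1) y)) &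
      (forall y, sqI (Iu v) (dot (w.1.1 - v.1.1) y))].

Section Model.
Variables (R : comNzRingType) (m : nat) (E : 'M[R]_m).
Hypothesis EE : E *m E = E.
Implicit Types (u v w : qt R m).

Lemma Iu_ideal u : is_ideal (Iu u).
Proof.
split; first by exists 0, 0; rewrite dot0r mul0r addr0.
split=> [_ _ [y [z ->]] [y' [z' ->]]|a _ [y [z ->]]].
  by exists (y + y'), (z + z'); rewrite dotDr mulrDl addrACA.
by exists (a *: y), (a * z); rewrite dotZr mulrDr mulrA.
Qed.

Lemma Iu_dot u y : Iu u (dot u.1.1 y).
Proof. by exists y, 0; rewrite mul0r addr0. Qed.

Lemma Iu_s u : Iu u u.2.
Proof. by exists 0, 1; rewrite dot0r mul1r add0r. Qed.

Lemma Iu_sub u (I : R -> Prop) : is_ideal I -> (forall y, I (dot u.1.1 y)) -> I u.2 ->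
  forall a, Iu u a -> I a.
Proof. by move=> hI h1 h2 a [y [z ->]]; apply: idealD => //; apply: ideal_mull. Qed.

Lemma QE_eq u : QE E u -> dot u.1.1 u.1.2 = u.2 * (1 - u.2).
Proof. by case=> _ _ h; apply/eqP; rewrite -subr_eq0 -h; apply/eqP; ring. Qed.

(** By the quadric equation [(1 - s) s = f(p)]. *)
Lemma Iu_mul1s u a : QE E u -> Iu u a -> dotI u.1.1 ((1 - u.2) * a).
Proof.
move=> hu [y [z ->]]; exists ((1 - u.2) *: y + z *: u.1.2).
by rewrite dotDr !dotZr (QE_eq hu); ring.
Qed.

(** The error [s * a] is in the square; this is the surjectivity of the orientation induced by
    [u]. *)
Lemma Iu_mod_sq u a : QE E u -> Iu u a -> exists y, sqI (Iu u) (a - dot u.1.1 y).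
Proof.
move=> hu ha; have [y hy] := Iu_mul1s hu ha; exists y; rewrite -hy.
have -> : a - (1 - u.2) * a = u.2 * a by ring.
by apply: prodI_mul => //; apply: Iu_s.
Qed.

Lemma QE_Gam u : QE E u -> QE E (Gamq u).
Proof. by move=> [h1 h2 h3]; split=> //=; rewrite -[RHS]h3; ring. Qed.

(** With [c = h(p)], the new [s' = s + (1 - s) c] has [s' (1 - s') = (1 - c) (s (1 - s) + (1 - s)^2
    c)], which is the new functional at [(1 - c) p]. *)
Lemma QE_Nm h u : h *m E = h -> QE E u -> QE E (Nm h u).
Proof.
move=> hh hu; have e := QE_eq hu; case: hu => h1 h2 _; split=> /=.
- by rewrite mulmxDl -scalemxAl h1 hh.
- by rewrite -scalemxAr h2.
- by rewrite dotDl dotZl !dotZr e; ring.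
Qed.

Lemma Nm0 u : Nm 0 u = u.
Proof.
case: u => [[f x] s]; rewrite /Nm /= dot0l scaler0 addr0 subr0 scale1r mulr1.
by congr (_, _, _); ring.
Qed.

Lemma QE_map (S : comNzRingType) (h : {rmorphism R -> S}) u :
  QE E u -> QE (map_mx h E) (mapq h u).
Proof.
move=> [h1 h2 h3]; split=> /=; rewrite -?map_mxM ?h1 ?h2 //.
by rewrite dot_map -(rmorph1 h) -rmorphB -rmorphM -rmorphD h3 rmorph0.
Qed.

Lemma Iu_map (S : comNzRingType) (h : {rmorphism R -> S}) u a :
  Iu u a -> Iu (mapq h u) (h a).
Proof.
move=> [y [z ->]]; exists (map_mx h y), (h z).
by rewrite rmorphD rmorphM dot_map.
Qed.

Lemma Iu_map_inv (S : comNzRingType) (h : {rmorphism R -> S}) (sec : S -> R) u b :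
  cancel sec h -> Iu (mapq h u) b -> exists a, Iu u a /\ h a = b.
Proof.
move=> hs [y [z ->]]; exists (dot u.1.1 (map_mx sec y) + sec z * u.2); split.
  by exists (map_mx sec y), (sec z).
rewrite rmorphD rmorphM hs -dot_map /=; congr (dot _ _ + _).
by apply/matrixP => i j; rewrite !mxE hs.
Qed.

Lemma mapq_Nm (S : comNzRingType) (h : {rmorphism R -> S}) g u :
  mapq h (Nm g u) = Nm (map_mx h g) (mapq h u).
Proof.
rewrite /mapq /Nm /= !dot_map map_mxD !map_mxZ rmorphXn !rmorphB rmorphM !rmorphB rmorph1.
by [].
Qed.

Lemma dotE (f : 'rV[R]_m) y : f *m E = f -> dot f (E *m y) = dot f y.
Proof. by move=> h; rewrite -dotA h. Qed.

(** Nakayama over the image of [f] gives [e] in [M] with [(1 - e) M] inside that image. In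
    particular [(1 - e) e = f(y)], which is the quadric equation with [s = e]. *)
Lemma lift_orientation (f : 'rV[R]_m) (M : R -> Prop) (a : seq R) :
  f *m E = f -> is_ideal M -> same_ideal M (Defs.span a) -> (forall y, M (dot f y)) ->
  (forall b, M b -> exists y, sqI M (b - dot f y)) ->
  exists x s, QE E (f, x, s) /\ Iu (f, x, s) = M.
Proof.
move=> fE hM ha hf hMf.
have [b Mb|e [Me he]] := nakayama hM (dotI_ideal f) ha.
  have [y hy] := hMf b Mb; exists (dot f y), (b - dot f y); split; first by exists y.
  by split=> //; rewrite addrC subrK.
have [y hy] := he e Me; exists (E *m y), e; split.
  split=> //=; first by rewrite mulmxA EE.
  by rewrite dotE // -hy; ring.
apply: pred_ext => b; split.
  by apply: Iu_sub => //=.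
move=> /[dup] /he [z hz] Mb; exists z, b => /=; rewrite -hz; ring.
Qed.

(** [eisenbud_evans] with [V = E]: as [E] has rank at least [n] everywhere, its hypothesis reduces
    to [D 0]. Points where [1 - s] vanishes are harmless, because there the new [s] equals 1. The
    parameters [h0] and [a] allow the move to be prescribed where [a] vanishes. *)
Lemma general_position (D : nat -> (R -> Prop) -> Prop) n u (h0 : 'rV[R]_m) (a : R) :
  dimp D -> (forall (K : fieldType) (f : {rmorphism R -> K}), (n <= \rank (map_mx f E))%N) ->
  QE E u -> h0 *m E = h0 ->
  exists g, g *m E = g /\ forall (K : fieldType) (f : {rmorphism R -> K}), f a != 0 ->
    (forall c, Iu (Nm (h0 + a *: g) u) c -> f c = 0) -> D n (rker f).
Proof.
move=> hD hr hu hh0.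
have [K f r fa rm hrk|g hg] := @eisenbud_evans R D m m n (a * (1 - u.2) ^+ 2)
  (u.1.1 + (1 - u.2) ^+ 2 *: h0) E hD.
  have nr : (n <= r)%N.
    apply: leq_trans (hr K f) (leq_trans _ hrk); apply: mxrankS.
    by rewrite map_col_mx; apply: col_mx_subl.
  have -> : (n - r = 0)%N by lia.
  exact/hD.1/rker_prime.
exists (g *m E); split; first by rewrite -mulmxA EE.
move=> K f fa hI; apply: hg.
  rewrite rmorphM mulf_neq0 // rmorphXn expf_neq0 //; apply/eqP => h.
  have := hI _ (Iu_s _); rewrite /= rmorphB rmorphM h mul0r subr0 rmorph1.
  by apply/eqP; rewrite oner_eq0.
have -> : u.1.1 + (1 - u.2) ^+ 2 *: h0 + (a * (1 - u.2) ^+ 2) *: (g *m E)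
    = (Nm (h0 + a *: (g *m E)) u).1.1.
  by rewrite /= scalerDr scalerA addrA [_ * a]mulrC.
by apply/rowP => j; rewrite [LHS]mxE [RHS]mxE -dot_delta; apply: hI; apply: Iu_dot.
Qed.

(** Chinese remaindering modulo the squares of the two ideals glues the functionals;
    [lift_orientation] then completes the result to a triple over the intersection. *)
Lemma comax_Prodq u v : noetherian R -> QE E u -> QE E v -> comax (Iu u) (Iu v) ->
  exists w, Prodq E u v w.
Proof.
move=> Rn hu hv hc; have iu := Iu_ideal u; have iv := Iu_ideal v.
have iu2 := prodI_ideal (Iu u) iu; have iv2 := prodI_ideal (Iu v) iv.
have [al [be [hal [hbe hab]]]] := comax_sq iu iv hc.
have ebe : be = 1 - al by rewrite -hab; ring.
have eal : al = 1 - be by rewrite -hab; ring.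
pose f := be *: u.1.1 + al *: v.1.1.
have fE : f *m E = f.
  by case: hu hv => [h _ _] [h' _ _]; rewrite mulmxDl -!scalemxAl h h'.
pose M := fun a => Iu u a /\ Iu v a.
have hM : is_ideal M := capI_ideal iu iv.
have [a ha] := Rn M hM.
have cu y : sqI (Iu u) (dot (f - u.1.1) y).
  have -> : dot (f - u.1.1) y = al * dot (v.1.1 - u.1.1) y.
    by rewrite dotBl dotBl dotDl !dotZl ebe; ring.
  exact: (ideal_mulr _ iu2).
have cv y : sqI (Iu v) (dot (f - v.1.1) y).
  have -> : dot (f - v.1.1) y = be * dot (u.1.1 - v.1.1) y.
    by rewrite dotBl dotBl dotDl !dotZl eal; ring.
  exact: (ideal_mulr _ iv2).
have [||x [s [hw hI]]] := lift_orientation fE hM ha.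
- move=> y; split.
    have /(sqI_sub iu) h := cu y; apply: (ideal_eq_sub iu (y := dot u.1.1 y)).
      by rewrite -dotBl.
    exact: Iu_dot.
  have /(sqI_sub iv) h := cv y; apply: (ideal_eq_sub iv (y := dot v.1.1 y)).
    by rewrite -dotBl.
  exact: Iu_dot.
- move=> b [bu bv]; have [y hy] := Iu_mod_sq hu bu; have [y' hy'] := Iu_mod_sq hv bv.
  exists (be *: y + al *: y'); apply: comax_sq_cap => //.
    have -> : b - dot f (be *: y + al *: y') = (b - dot u.1.1 y) - dot (f - u.1.1) (be *: y + al *: y')
       + al * (dot u.1.1 y - dot u.1.1 y').
      by rewrite dotBl !dotDr !dotZr ebe; ring.
    apply: (idealD iu2); last exact: (ideal_mulr _ iu2).
    exact: (idealB iu2 hy (cu _)).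
  have -> : b - dot f (be *: y + al *: y') = (b - dot v.1.1 y') - dot (f - v.1.1) (be *: y + al *: y')
       + be * (dot v.1.1 y' - dot v.1.1 y).
    by rewrite dotBl !dotDr !dotZr eal; ring.
  apply: (idealD iv2); last exact: (ideal_mulr _ iv2).
  exact: (idealB iv2 hy' (cv _)).
exists (f, x, s); split=> //; by rewrite comax_prodE.
Qed.

End Model.

(** * Homotopies in the matrix model *)

Lemma dot_polyC (A : comNzRingType) m (f : 'rV[A]_m) (x : 'cV[A]_m) :
  dot (map_mx polyC f) (map_mx polyC x) = (dot f x)%:P.
Proof. exact: dot_map. Qed.

Section Homotopy.
Variables (A : comNzRingType) (m : nat) (E : 'M[A]_m).
Hypothesis EE : E *m E = E.
Hypothesis An : noetherian A.
Implicit Types (u v w : qt A m).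

Definition ET : 'M[{poly A}]_m := map_mx polyC E.

Lemma ETET : ET *m ET = ET. Proof. by rewrite /ET -map_mxM EE. Qed.

Lemma evE (t : A) p : (horner_eval t : {rmorphism {poly A} -> A}) p = p.[t].
Proof. by []. Qed.

Definition evq (t : A) (U : qt {poly A} m) : qt A m := mapq (horner_eval t) U.

Lemma ev_polyC (t : A) n p (X : 'M[A]_(n, p)) : map_mx (horner_eval t) (map_mx polyC X) = X.
Proof. by apply/matrixP => i j; rewrite !mxE /horner_eval hornerC. Qed.

Lemma polyC_ev (t : A) : cancel (@polyC A) (horner_eval t).
Proof. by move=> x; rewrite /horner_eval hornerC. Qed.

Lemma QE_ev t U : QE ET U -> QE E (evq t U).
Proof. by move/(QE_map (horner_eval t)); rewrite /ET ev_polyC. Qed.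

Definition cstq u : qt {poly A} m := mapq polyC u.

Lemma QE_cst u : QE E u -> QE ET (cstq u).
Proof. exact: QE_map. Qed.

Lemma evq_cst t u : evq t (cstq u) = u.
Proof.
by case: u => [[f x] s]; rewrite /evq /cstq /mapq /= !ev_polyC ?evE /horner_eval hornerC.
Qed.

Definition hom0 u v : Prop := exists U, [/\ QE ET U, evq 0 U = u & evq 1 U = v].
Definition heq : qt A m -> qt A m -> Prop := clos_refl_sym_trans _ hom0.

Lemma heq_refl u : heq u u. Proof. exact: rst_refl. Qed.
Lemma heq_sym u v : heq u v -> heq v u. Proof. exact: rst_sym. Qed.
Lemma heq_trans u v w : heq u v -> heq v w -> heq u w. Proof. exact: rst_trans. Qed.
Lemma heq_step U : QE ET U -> heq (evq 0 U) (evq 1 U).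
Proof. by move=> h; apply: rst_step; exists U. Qed.

Lemma heq_QE u v : heq u v -> QE E u <-> QE E v.
Proof.
elim=> {u v} [u v [U [h <- <-]]|//|u v _ [? ?]|u v w _ [? ?] _ [? ?]]; split; auto => _; exact: QE_ev.
Qed.

Lemma heq_Gam u v : heq u v -> heq (Gamq u) (Gamq v).
Proof.
elim=> {u v} [u v [U [h <- <-]]|u|u v _ h|u v w _ h _ h'].
- have e t : Gamq (evq t U) = evq t (Gamq U).
    by rewrite /evq /Gamq /mapq /= ?evE /horner_eval hornerD hornerN hornerC.
  by rewrite !e; apply: heq_step; apply: QE_Gam.
- exact: heq_refl.
- exact: heq_sym.
- exact: heq_trans h h'.
Qed.

(** [Nm] commutes with evaluation, so [Nm (T h) u] over [A[T]] joins [Nm 0 u = u] to [Nm h u]. *)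
Lemma heq_Nm h u : h *m E = h -> QE E u -> heq u (Nm h u).
Proof.
move=> hh hu; pose U := Nm ('X *: map_mx polyC h) (cstq u).
have e t : evq t U = Nm (t *: h) u.
  rewrite /evq mapq_Nm -/(evq _ _) evq_cst; congr Nm; apply/matrixP => i j.
  by rewrite !mxE ?evE /horner_eval hornerM hornerX hornerC.
have := @heq_step U; rewrite !e scale0r scale1r Nm0; apply; apply: QE_Nm.
  by rewrite -scalemxAl /ET -map_mxM hh.
exact: QE_cst.
Qed.

Lemma heq_same_functional (f : 'rV[A]_m) x x' s s' (v : 'cV[A]_m) :
  QE E (f, x, s) -> QE E (f, x', s') -> s' - s = dot f v -> heq (f, x, s) (f, x', s').
Proof.
move=> h h' hs; pose pc n p := @map_mx _ _ (@polyC A) n p.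
have hv : dot f (E *m v) = dot f v by rewrite -dotA; case: h => /= ->.
pose c : {poly A} := (dot f v)%:P.
(* Moving [s] to [s + T c] changes [s (1 - s)] by [c (T (1 - 2 s) - T^2 c)]; with [c = f(v)] a
   multiple of [E v] added to [x] compensates. *)
pose U : qt {poly A} m := (pc _ _ f, pc _ _ x + ('X * (1 - 2%:R * s%:P) - 'X ^+ 2 * c) *: pc _ _ (E *m v),
   s%:P + 'X * c).
have eU t : evq t U = (f, x + (t * (1 - 2%:R * s) - t ^+ 2 * dot f v) *: (E *m v), s + t * dot f v).
  rewrite /evq /mapq /U /= ev_polyC map_mxD map_mxZ !ev_polyC ?evE /horner_eval !hornerE.
  by congr (_, _ + _ *: _, _); rewrite !hornerE.
have hU : QE ET U.
  have e := QE_eq h; case: h => /= h1 h2 _; split=> /=; rewrite ?mulmxDr -?scalemxAr -?map_mxM ?h1 ?h2 //.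
    by rewrite mulmxA EE.
  rewrite dotDr dotZr !dot_polyC hv e -/c polyCM polyCB polyC1; ring.
have hU0 := QE_ev 1 hU.
have e0 : evq 0 U = (f, x, s).
  by rewrite eU !mul0r expr0n /= mul0r subr0 scale0r !addr0.
have := heq_step hU; rewrite e0 => /heq_trans; apply; move: hU0; rewrite eU mul1r.
set x1 := x + _; rewrite mul1r -hs [s + _]addrC subrK => hx1.
(* For fixed [f] and [s'] the equation is affine in the vector, so a segment joins two solutions. *)
pose V : qt {poly A} m := (pc _ _ f, (1 - 'X) *: pc _ _ x1 + 'X *: pc _ _ x', s'%:P).
have eV t : evq t V = (f, (1 - t) *: x1 + t *: x', s').
  rewrite /evq /mapq /V /= ev_polyC map_mxD !map_mxZ !ev_polyC ?evE /horner_eval hornerC.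
  by rewrite hornerD hornerN hornerC hornerX.
have hV : QE ET V.
  have ex := QE_eq hx1; have ex' := QE_eq h'; case: hx1 h' => /= a1 a2 _ [/= _ a3 _].
  split=> /=; rewrite ?mulmxDr -?scalemxAr -?map_mxM ?a1 ?a2 ?a3 //.
  by rewrite dotDr !dotZr !dot_polyC ex ex' polyCM polyCB polyC1; ring.
have := heq_step hV; rewrite !eV subr0 subrr scale1r !scale0r scale1r addr0 add0r.
exact.
Qed.

(** [s' - s = (1 - s) s' - (1 - s') s], and both terms lie in the image of [f]. *)
Lemma heq_same_ideal (f : 'rV[A]_m) x x' s s' :
  QE E (f, x, s) -> QE E (f, x', s') -> Iu (f, x, s) = Iu (f, x', s') ->
  heq (f, x, s) (f, x', s').
Proof.
move=> h h' e.
have [y hy] : dotI f ((1 - s) * s') by apply: (Iu_mul1s h); rewrite e; apply: (Iu_s (f, x', s')).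
have [y' hy'] : dotI f ((1 - s') * s) by apply: (Iu_mul1s h'); rewrite -e; apply: (Iu_s (f, x, s)).
apply: (heq_same_functional (v := y - y')) => //.
by rewrite dotBr -hy -hy'; ring.
Qed.

Lemma sqI_polyC (I : A -> Prop) c : is_ideal I -> sqI I c -> sqI (extI I) c%:P.
Proof.
move=> hI; have h := prodI_ideal (extI I) (extI_ideal hI).
apply: (@prodI_sub _ _ _ (fun c => sqI (extI I) c%:P)).
  split; first by rewrite polyC0; apply: (ideal0 h).
  split=> [x y hx hy|a x hx]; first by rewrite polyCD; apply: (idealD h).
  by rewrite polyCM; apply: (ideal_mull _ h).
by move=> x y hx hy; rewrite polyCM; apply: prodI_mul; apply: extI_poly.
Qed.

Lemma heq_orientation u v : QE E u -> QE E v -> Iu u = Iu v ->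
  (forall y, sqI (Iu u) (dot (v.1.1 - u.1.1) y)) -> heq u v.
Proof.
case: u v => [[f x] s] [[f' x'] s'] hu hv eI /= hd.
set I := Iu _ in eI hd; have hI : is_ideal I := Iu_ideal _.
have hM := extI_ideal hI; have hM2 := prodI_ideal (extI I) hM.
have [a ha] := noetherian_poly An hM.
pose d := f' - f.
pose F : 'rV[{poly A}]_m := map_mx polyC f + 'X *: map_mx polyC d.
have [h1 _ _] := hu; have [h2 _ _] := hv; rewrite /= in h1 h2.
have FE : F *m ET = F.
  by rewrite mulmxDl -scalemxAl -!map_mxM h1 mulmxBl h1 h2.
have Fpc y : dot F (map_mx polyC y) = (dot f y)%:P + 'X * (dot d y)%:P.
  by rewrite dotDl dotZl !dot_polyC.
have [||X [S [hU eU]]] := lift_orientation ETET FE hM ha.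
- move=> y; apply: dot_ideal => // j; rewrite -dot_delta.
  have -> : delta_mx j 0 = map_mx polyC (delta_mx j 0) :> 'cV[{poly A}]_m by rewrite map_delta_mx.
  rewrite Fpc; apply: (idealD hM); first by apply: extI_poly => //; apply: (Iu_dot (f, x, s)).
  by apply: (ideal_mull _ hM); apply: extI_poly => //; apply: sqI_sub.
- pose P g := exists y, sqI (extI I) (g - dot F y).
  apply: (@extI_sub _ P I).
    split; first by exists 0; rewrite dot0r subr0; apply: (ideal0 hM2).
    split=> [g g' [y hy] [y' hy']|g b [y hy]].
      by exists (y + y'); rewrite dotDr opprD addrACA; apply: (idealD hM2).
    by exists (g *: y); rewrite dotZr -mulrBr; apply: (ideal_mull _ hM2).
  move=> c Ic; have [y hy] := Iu_mod_sq hu Ic; exists (map_mx polyC y).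
  rewrite Fpc opprD addrA -polyCB; apply: (idealB hM2); first exact: sqI_polyC.
  by apply: (ideal_mull _ hM2); apply: sqI_polyC.
have eI' t : Iu (evq t (F, X, S)) = I.
  apply: pred_ext => c; split.
    move/(Iu_map_inv (polyC_ev t)) => [g []]; rewrite eU => hg <-.
    rewrite ?evE /horner_eval horner_coef; apply: ideal_sum => // i _; exact: ideal_mulr.
  by move=> Ic; rewrite -(polyC_ev t c); apply: Iu_map; rewrite eU; apply: extI_poly.
have eF t : evq t (F, X, S) = (f + t *: d, map_mx (horner_eval t) X, horner_eval t S).
  rewrite /evq /mapq /= map_mxD map_mxZ !ev_polyC; congr (_ + _ *: _, _, _).
  by rewrite ?evE /horner_eval hornerX.
have := heq_step hU; have := eI' 0; have := eI' 1; have := QE_ev 0 hU; have := QE_ev 1 hU.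
rewrite !eF scale0r addr0 scale1r /d addrC subrK => q1 q0 i1 i0 hst.
(* The ends of the lifted homotopy have the functionals [f], [f'] and the ideal [I], but possibly
   other [x] and [s]. *)
apply: heq_trans (heq_same_ideal hu q0 _) _; first by rewrite i0.
apply: heq_trans hst _; apply: heq_same_ideal => //; by rewrite i1.
Qed.

(** The two functionals agree modulo both squares, hence modulo the square of the product ideal. *)
Lemma Prodq_uniq u v w w' : QE E u -> QE E v -> comax (Iu u) (Iu v) ->
  Prodq E u v w -> Prodq E u v w' -> heq w w'.
Proof.
move=> hu hv hc [q e c1 c2] [q' e' c1' c2']; apply: heq_orientation => //; first by rewrite e e'.
move=> y; rewrite e comax_prodE //; try exact: Iu_ideal.
have split_dot z : dot (w'.1.1 - w.1.1) y = dot (w'.1.1 - z) y - dot (w.1.1 - z) y.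
  by rewrite !dotBl; ring.
apply: comax_sq_cap => //; try exact: Iu_ideal.
  by rewrite (split_dot u.1.1); apply: idealB => //; apply: prodI_ideal; apply: Iu_ideal.
by rewrite (split_dot v.1.1); apply: idealB => //; apply: prodI_ideal; apply: Iu_ideal.
Qed.

End Homotopy.


(** * Dimension functions and moving *)

Section Dimension.
Variable R : comNzRingType.
Implicit Types (L I p : R -> Prop).

(** Says that [p / L] has height at least [t] in [R / L]. *)
Definition chain_over L p t : Prop :=
  exists c, [/\ prime_chain c t, c t = p & forall x, L x -> c 0%N x].

Lemma chain_over0 L p : is_prime p -> (forall x, L x -> p x) -> chain_over L p 0.
Proof. by move=> hp h; exists (fun _ => p); split=> //; split=> // i; rewrite ltn0. Qed.

Lemma chain_overS L p p' t : chain_over L p t -> is_prime p' -> strict_sub p p' ->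
  chain_over L p' t.+1.
Proof.
move=> [c [[hc1 hc2] ec hL]] hp' hs.
exists (fun i => if (i <= t)%N then c i else p'); split; last by [].
- split=> i hi.
    by case: leqP => h //; apply: hc1.
  rewrite -ltnS hi; case: (ltnP i t) => h; first exact: hc2.
  by have -> : i = t by [apply/eqP; rewrite eqn_leq h -ltnS hi]; rewrite ec.
- by rewrite ltnn.
Qed.

(** Says that [R / L] has dimension less than [t]. *)
Definition no_chain L t : Prop := forall p, ~ chain_over L p t.

Lemma no_chainS L t : no_chain L t -> no_chain L t.+1.
Proof.
move=> h p [c [[hc1 hc2] _ hL]]; apply: (h (c t)); exists c; split=> //.
by split=> i hi; [apply: hc1; apply: ltnW | apply: hc2; apply: ltnW].
Qed.

(** A chain of length [n] below the bottom prime and one of length [n - 1] above it join to length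
    [2n - 1 >= d + 1]. *)
Lemma height_no_chain d n L : krull_dim R d -> (d + 2 <= 2 * n)%N -> height_ge L n ->
  no_chain L n.-1.
Proof.
move=> [_ hd] hn hL p [c [[hc1 hc2] _ hc0]].
have [c' [[hc1' hc2'] e']] := hL (c 0%N) (hc1 0%N (leq0n _)) hc0.
have e0 : c' n = c 0%N by apply: pred_ext.
apply: hd; exists (fun i => if (i <= n)%N then c' i else c (i - n)%N); split=> i hi.
  by case: leqP => h; [apply: hc1' | apply: hc1; lia].
case: (ltngtP i n) => h.
- exact: hc2'.
- have -> : (i.+1 - n = (i - n).+1)%N by lia.
  by apply: hc2; lia.
- by rewrite h e0 subSnn; apply: hc2; lia.
Qed.

(** Nothing is asked at primes not containing [L], so the functions of several ideals can be
    combined by conjunction. *)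
Definition dim_over L (t : nat) p : Prop := (forall x, L x -> p x) -> chain_over L p t.

Lemma strict_or_eq I p : (forall x, I x -> p x) -> I = p \/ strict_sub I p.
Proof.
move=> h; have [h'|/not_all_ex_not [x hx]] := classic (forall x, p x -> I x).
  by left; apply: pred_ext => x; split; auto.
by right; split=> //; exists x; apply: imply_to_and.
Qed.

(** A prime over [Z + L] is on the list of [finite_primes] or strictly contains a member of it; in
    the second case the chain gains a step. *)
Lemma dimp_over L : noetherian R -> is_ideal L -> dimp (dim_over L).
Proof.
move=> Rn hL; split; first by move=> p hp h; apply: chain_over0.
move=> t Z a hZ hD; have [l [h1 h2]] := finite_primes Rn (addI_ideal hZ hL).
exists l; split; first by move=> p /h1 [].
move=> Q pQ ZQ nQa; have [LQ|nLQ] := classic (forall x, L x -> Q x); last by right.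
have [|p [pl pQs]] := h2 Q pQ.
  by move=> _ [y [z [Zy [Lz ->]]]]; apply: (idealD (prime_ideal pQ)); auto.
have [pp sub] := h1 p pl.
have [<-|hs] := strict_or_eq pQs; first by left.
right=> _; apply: (chain_overS _ pQ hs); apply: hD => // [x Zx||x Lx].
- by apply: sub; apply: addI_l.
- by move=> pa; apply: nQa; apply: pQs.
- by apply: sub; apply: addI_r.
Qed.

Lemma dimp_and (D1 D2 : nat -> (R -> Prop) -> Prop) : dimp D1 -> dimp D2 ->
  dimp (fun t p => D1 t p /\ D2 t p).
Proof.
move=> [h1 h1'] [h2 h2']; split; first by move=> p pp; split; auto.
move=> t Z a hZ hD.
have [l1 [p1 q1]] := h1' t Z a hZ (fun Q pQ ZQ nQ => (hD Q pQ ZQ nQ).1).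
have [l2 [p2 q2]] := h2' t Z a hZ (fun Q pQ ZQ nQ => (hD Q pQ ZQ nQ).2).
exists (l1 ++ l2)%list; split; first by move=> p /List.in_app_iff [/p1|/p2].
move=> Q pQ ZQ nQ; rewrite List.in_app_iff.
have := q1 Q pQ ZQ nQ; have := q2 Q pQ ZQ nQ; tauto.
Qed.

Lemma comax_residue I J : noetherian R -> is_ideal I -> is_ideal J ->
  (forall (K : fieldType) (f : {rmorphism R -> K}),
     (forall x, I x -> f x = 0) -> (forall x, J x -> f x = 0) -> False) -> comax I J.
Proof.
move=> Rn hI hJ h; apply: NNPP => nc.
have [|p [pp hp]] := prime_over Rn (addI_ideal hI hJ).
  by move=> [a [b [Ia [Jb e]]]]; apply: nc; exists a, b.
have [K [f ef]] := residue_field pp.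
apply: (h K f) => x hx; rewrite -/(rker f x) ef; apply: hp; [exact: addI_l | exact: addI_r].
Qed.
End Dimension.

(** * A dimension function on the polynomial ring *)

Section PolyDimension.
Variable A : comNzRingType.
Hypothesis An : noetherian A.

Definition extended (Q : {poly A} -> Prop) : Prop := forall g, Q g -> extI (contr Q) g.

(* The height in [A[T] / K[T]] of [Q], computed as the height of the contraction in [A / K], plus
   one when [Q] is not extended from [A]; no dimension theory of [A[T]] is needed for it. *)
Definition dim_poly (K : A -> Prop) (t : nat) (Q : {poly A} -> Prop) : Prop :=
  (forall c, K c -> contr Q c) ->
  chain_over K (contr Q) t \/
  exists t', [/\ t = t'.+1, chain_over K (contr Q) t' & ~ extended Q].

Lemma extended_eq Q : is_ideal Q -> extended Q -> Q = extI (contr Q).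
Proof.
by move=> hQ h; apply: pred_ext => g; split; [exact: h | exact: extI_sub].
Qed.

(** If [p] is not extended, some element of it has a coefficient [c] outside the contraction of [p].
    A prime containing all coefficients of [p] contains [c], hence one of the finitely many [r]
    listed over the contraction and [c]. *)
Lemma extensions_above p : is_prime p ->
  exists L : list ({poly A} -> Prop), (forall q, List.In q L -> is_prime q) /\
    (~ extended p -> forall q, is_prime q -> (forall g, p g -> extI q g) ->
     exists r, [/\ List.In (extI r) L, is_prime r, strict_sub (contr p) r & forall x, r x -> q x]).
Proof.
move=> pp; have [he|he] := classic (extended p); first by exists nil; split.
have pc := contr_prime pp.
have [g hg] := not_all_ex_not _ _ he; have [pg ng] := imply_to_and _ _ hg.
have [i ni] := not_all_ex_not _ _ ng; set c := g`_i in ni.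
have [l [h1 h2]] := finite_primes An (addI_ideal (prime_ideal pc) (prinI_ideal c)).
exists (List.map (@extI A) l); split.
  by move=> q /List.in_map_iff [r [<- /h1 [pr _]]]; apply: extI_prime.
move=> _ q pq hpq; have [|r [rl rq]] := h2 q pq.
  move=> _ [y [z [hy [[b ->] ->]]]]; apply: (idealD (prime_ideal pq)).
    by have := hpq _ hy 0%N; rewrite coefC.
  by apply: (ideal_mull _ (prime_ideal pq)); apply: hpq.
have [pr sub] := h1 r rl; exists r; split=> //.
  by apply/List.in_map_iff; exists r.
split; first by move=> x hx; apply: sub; apply: addI_l => //; apply: prinI_ideal.
exists c; split=> //; apply: sub; apply: addI_r; [exact: prime_ideal pc | exact: prinI_id].
Qed.

(* A prime [Q] above a component [Q0] of the closed set has larger dimension, except when [Q] is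
   extended and [Q0] is not; then [Q ∩ A] contains a coefficient [c] of an element of [Q0] with [c]
   outside [Q0], so that either [Q ∩ A] is one of the finitely many primes minimal over
   [Q0 ∩ A + (c)], or the chain of contractions gains two steps. *)
Lemma dimp_poly (K : A -> Prop) : is_ideal K -> dimp (dim_poly K).
Proof.
move=> hK; split; first by move=> Q pQ h; left; apply: chain_over0 => //; apply: contr_prime.
move=> t Z a hZ hD.
have [l [h1 h2]] := finite_primes (noetherian_poly An) (addI_ideal hZ (extI_ideal hK)).
have [L' [hL1 hL2]] : exists L : list ({poly A} -> Prop), (forall q, List.In q L -> is_prime q) /\
    forall p, List.In p l -> ~ extended p -> forall q, is_prime q -> (forall g, p g -> extI q g) ->
     exists r, [/\ List.In (extI r) L, is_prime r, strict_sub (contr p) r & forall x, r x -> q x].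
  elim: (l) (fun p hp => (h1 p hp).1) => [_|p l' IH hl]; first by exists nil.
  have [L1 [a1 b1]] := extensions_above (hl p (or_introl erefl)).
  have [L2 [a2 b2]] := IH (fun q hq => hl q (or_intror hq)).
  exists (L1 ++ L2)%list; split; first by move=> q /List.in_app_iff [/a1|/a2].
  move=> p' [<-|hp'] ne q pq hq.
    by have [r [r1 r2 r3 r4]] := b1 ne q pq hq; exists r; split=> //; apply/List.in_app_iff; left.
  by have [r [r1 r2 r3 r4]] := b2 p' hp' ne q pq hq; exists r; split=> //; apply/List.in_app_iff; right.
exists (l ++ L')%list; split; first by move=> p /List.in_app_iff [/h1 []|/hL1].
move=> Q pQ ZQ nQa; rewrite List.in_app_iff.
have [KQ|nKQ] := classic (forall x, K x -> contr Q x); last by right.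
have iQ := prime_ideal pQ; have pcQ := contr_prime pQ.
have [|p [pl pQs]] := h2 Q pQ.
  move=> _ [y [z [Zy [Lz ->]]]]; apply: (idealD iQ); auto.
  exact: (extI_sub iQ KQ).
have [pp sub] := h1 p pl; have pcp := contr_prime pp.
have [<-|hs] := strict_or_eq pQs; first by left; left.
have Kp x : K x -> contr p x.
  by move=> Kx; apply: sub; apply: addI_r => //; apply: extI_poly.
have Dp : dim_poly K t p.
  apply: hD => // [x Zx|]; first by apply: sub; apply: addI_l => //; apply: extI_ideal.
  by move=> pa; apply: nQa; apply: pQs.
have csub x : contr p x -> contr Q x by exact: pQs.
(* For equal contractions, [contr_chain] makes [p] extended; the larger [Q] is then not extended,
   which supplies the extra unit. *)
have [ec|hcs] := strict_or_eq csub.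
  right; right; exists t; split=> //; rewrite -?ec.
    case: (Dp Kp) => // -[t' [_ _ ne]]; case: ne; rewrite /extended.
    by apply: (contr_chain pp pQ hs) => c; rewrite ec.
  move=> eQ; have ep : extended p by move=> g pg; rewrite ec; apply: eQ; apply: pQs.
  case: hs => _ [g [Qg]]; apply; rewrite (extended_eq (prime_ideal pp) ep) ec; exact: eQ.
case: (Dp Kp) => [hc|[t' [et hc ne]]]; first by right; left; apply: (chain_overS hc).
have [eQ|neQ] := classic (extended Q); last first.
  by right; right; exists t; split=> //; rewrite et; apply: (chain_overS hc).
have [|r [r1 r2 r3 r4]] := hL2 p pl ne (contr Q) pcQ; first by move=> g pg; apply: eQ; apply: pQs.
have [er|rs] := strict_or_eq r4.
  by left; right; rewrite (extended_eq iQ eQ) -er.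
(* The two steps through [r] replace the unit that [p] owed to not being extended and add one
   more. *)
right; left; rewrite et; apply: (chain_overS _ pcQ rs); exact: (chain_overS hc).
Qed.
End PolyDimension.

(** * Moving triples and homotopies off an ideal *)

Section Moving.
Variables (A : comNzRingType) (m n : nat) (E : 'M[A]_m).
Hypothesis EE : E *m E = E.
Hypothesis An : noetherian A.
Hypothesis rankE : forall (K : fieldType) (f : {rmorphism A -> K}), (n <= \rank (map_mx f E))%N.
Implicit Types (u v w : qt A m).

Lemma rankET (K : fieldType) (f : {rmorphism {poly A} -> K}) :
  (n <= \rank (map_mx f (ET E)))%N.
Proof. by rewrite /ET -map_mx_comp; apply: (rankE (f \o polyC)). Qed.

(** Three dimension functions at once: over the zero ideal it measures height, and over [K1] and
    [K2] the value [n] is impossible by [no_chain], so no prime contains both the moved ideal and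
    one of them. *)
Lemma moving u (K1 K2 : A -> Prop) : QE E u -> is_ideal K1 -> is_ideal K2 ->
  no_chain K1 n -> no_chain K2 n ->
  exists h, [/\ h *m E = h, height_ge (Iu (Nm h u)) n, comax (Iu (Nm h u)) K1 &
     comax (Iu (Nm h u)) K2].
Proof.
move=> hu i1 i2 n1 n2.
have z_ideal : is_ideal (fun x : A => x = 0).
  by split=> //; split=> [x y -> ->|a x ->]; rewrite ?addr0 ?mulr0.
have hD := dimp_and (dimp_over An z_ideal) (dimp_and (dimp_over An i1) (dimp_over An i2)).
have [g [gE hg]] := general_position EE 1 hD rankE hu (mul0mx _ E).
rewrite add0r scale1r in hg.
have hc Ki : is_ideal Ki -> no_chain Ki n -> (forall (K : fieldType) (f : {rmorphism A -> K}),
    (forall c, Iu (Nm g u) c -> f c = 0) -> dim_over Ki n (rker f)) -> comax (Iu (Nm g u)) Ki.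
  move=> iK nK h; apply: comax_residue => //; first exact: Iu_ideal.
  by move=> K f hf hKf; apply: (nK (rker f)); apply: h.
have one (K : fieldType) (f : {rmorphism A -> K}) : f 1 != 0 by rewrite rmorph1 oner_eq0.
exists g; split=> //.
- move=> p pp hp; have [K [f ef]] := residue_field pp.
  have [|h _] := hg K f (one K f); first by move=> c /hp; rewrite -ef.
  have [|c [h1 h2 _]] := h; first by move=> x ->; rewrite /rker rmorph0.
  by exists c; split=> //; rewrite h2 ef.
- by apply: hc => // K f hf; have [_ []] := hg K f (one K f) hf.
- by apply: hc => // K f hf; have [_ []] := hg K f (one K f) hf.
Qed.

Lemma poly_eval_ker (K : fieldType) (f : {rmorphism {poly A} -> K}) t g :
  f ('X - t%:P) = 0 -> f g = f (g.[t])%:P.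
Proof.
move=> h; have : root (g - (g.[t])%:P) t by rewrite /root !hornerE subrr.
case/factor_theorem => q e; apply/eqP; rewrite -subr_eq0 -rmorphB e rmorphM h mulr0 //.
Qed.

Lemma comax_eval v (U : qt {poly A} m) : comax (Iu U) (Iu (cstq v)) -> forall t, comax (Iu (evq t U)) (Iu v).
Proof.
move=> [a [b [ha [hb e]]]] t; exists a.[t], b.[t].
have := Iu_map (horner_eval t) ha; have := Iu_map (horner_eval t) hb.
rewrite -/(evq _ _) evq_cst => h1 h2; split; first exact: h2.
by split=> //; rewrite -hornerD e hornerC.
Qed.

Variable v : qt A m.
Hypothesis hv : QE E v.
Hypothesis n0 : (0 < n)%N.
Hypothesis nv : no_chain (Iu v) n.-1.

Lemma nvn : no_chain (Iu v) n.
Proof. by rewrite -(prednK n0); apply: no_chainS. Qed.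

Lemma moving_homotopy H h0 h1 : QE (ET E) H -> h0 *m E = h0 -> h1 *m E = h1 ->
  comax (Iu (Nm h0 (evq 0 H))) (Iu v) -> comax (Iu (Nm h1 (evq 1 H))) (Iu v) ->
  exists U, [/\ QE (ET E) U, evq 0 U = Nm h0 (evq 0 H), evq 1 U = Nm h1 (evq 1 H) &
    comax (Iu U) (Iu (cstq v))].
Proof.
move=> hH e0 e1 c0 c1.
(* [hT] has the prescribed values at 0 and 1, and the correction supplied by [general_position] is
   multiplied by [T (1 - T)], so it leaves them alone. *)
pose hT : 'rV[{poly A}]_m := (1 - 'X) *: map_mx polyC h0 + 'X *: map_mx polyC h1.
have hTE : hT *m ET E = hT by rewrite mulmxDl -!scalemxAl -!map_mxM e0 e1.
have [g [gE hg]] := general_position (ETET EE) ('X * (1 - 'X)) (dimp_poly An (Iu_ideal v))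
  rankET hH hTE.
set a := 'X * _ in hg; pose U := Nm (hT + a *: g) H.
have eU t : evq t U = Nm ((1 - t) *: h0 + t *: h1 + (t * (1 - t)) *: map_mx (horner_eval t) g) (evq t H).
  rewrite /evq mapq_Nm; congr Nm; rewrite !map_mxD !map_mxZ !ev_polyC !evE.
  by rewrite hornerM hornerD hornerN hornerX hornerC.
have eU0 : evq 0 U = Nm h0 (evq 0 H) by rewrite eU subr0 scale1r mul0r !scale0r !addr0.
have eU1 : evq 1 U = Nm h1 (evq 1 H).
  by rewrite eU subrr mulr0 !scale0r scale1r addr0 add0r.
exists U; split=> //.
  by apply: QE_Nm => //; rewrite mulmxDl hTE -scalemxAl gE.
apply: (comax_residue (noetherian_poly An)); [exact: Iu_ideal | exact: Iu_ideal |].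
move=> K f hU hV.
have fv c : Iu v c -> f c%:P = 0 by move=> hc; apply: hV; apply: (Iu_map polyC hc).
(* A common zero on [T = t] would be one of the evaluated triple and [v]; at 0 and 1 this is
   excluded by [c0] and [c1]. *)
have ends t : comax (Iu (evq t U)) (Iu v) -> f ('X - t%:P) <> 0.
  move=> [b [c [hb [hc e]]]] ft.
  have [b' [hb' eb]] := Iu_map_inv (polyC_ev t) hb.
  have := hU _ hb'; rewrite (poly_eval_ker _ ft) => fb.
  have: f 1 = 0 by rewrite -polyC1 -e polyCD rmorphD (fv c hc) -eb addr0.
  by apply/eqP; rewrite rmorph1 oner_eq0.
have fa : f a != 0.
  rewrite rmorphM mulf_neq0 //; apply/eqP => h.
    by apply: (ends 0); [rewrite eU0 | rewrite polyC0 subr0].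
  apply: (ends 1); [by rewrite eU1 | by rewrite polyC1 -opprB rmorphN h oppr0].
(* Value [n] of [dim_poly] means a chain of length [n] or [n - 1] over [Iu v]. *)
have := hg K f fa hU; case=> //.
  exact: nvn.
by move=> [t' [et hc _]]; apply: (nv (p := contr (rker f))); rewrite et.
Qed.

Lemma Prodq_eval U W t : comax (Iu U) (Iu (cstq v)) -> Prodq (ET E) U (cstq v) W ->
  Prodq E (evq t U) v (evq t W).
Proof.
move=> hc [q e c1 c2].
have hsq (Z : qt {poly A} m) b : sqI (Iu Z) b -> sqI (Iu (evq t Z)) b.[t].
  have hi := prodI_ideal (Iu (evq t Z)) (Iu_ideal (evq t Z)).
  apply: (@prodI_sub _ _ _ (fun b : {poly A} => sqI (Iu (evq t Z)) b.[t])).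
    split; first by rewrite horner0; apply: (ideal0 hi).
    split=> [x y hx hy|a x hx]; first by rewrite hornerD; apply: (idealD hi).
    by rewrite hornerM; apply: (ideal_mull _ hi).
  by move=> x y hx hy; rewrite hornerM; apply: prodI_mul; apply: (Iu_map (horner_eval t)).
have hdot (Z : qt {poly A} m) y : dot ((evq t W).1.1 - (evq t Z).1.1) y =
    (dot (W.1.1 - Z.1.1) (map_mx polyC y)).[t].
  transitivity (dot (map_mx (horner_eval t) (W.1.1 - Z.1.1))
    (map_mx (horner_eval t) (map_mx polyC y))); first by rewrite ev_polyC map_mxB.
  exact: dot_map.
split; first exact: QE_ev.
- rewrite comax_prodE; [|exact: Iu_ideal|exact: Iu_ideal|exact: comax_eval].
  have ec := comax_eval hc t; apply: pred_ext => b; split.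
    move/(Iu_map_inv (polyC_ev t)) => [b' []]; rewrite e comax_prodE //; try exact: Iu_ideal.
    move=> [b1 b2] <-; split; first exact: Iu_map.
    by have := Iu_map (horner_eval t) b2; rewrite -/(evq _ _) evq_cst.
  move=> hb; have: prodI (Iu (evq t U)) (Iu v) b by rewrite comax_prodE //; exact: Iu_ideal.
  apply: prodI_sub; first exact: Iu_ideal.
  move=> x y /(Iu_map_inv (polyC_ev t)) [x' [hx' <-]] hy.
  have -> : horner_eval t x' * y = (horner_eval t : {rmorphism {poly A} -> A}) (x' * y%:P).
    by rewrite rmorphM !evE hornerC.
  apply: Iu_map; rewrite e; apply: prodI_mul => //; apply: (Iu_map polyC hy).
- by move=> y; rewrite hdot; apply: hsq; apply: c1.
- move=> y; have := hsq _ _ (c2 (map_mx polyC y)).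
  by rewrite -hdot evq_cst.
Qed.

Lemma Prodq_homotopy H h0 h1 w0 w1 : QE (ET E) H -> h0 *m E = h0 -> h1 *m E = h1 ->
  comax (Iu (Nm h0 (evq 0 H))) (Iu v) -> comax (Iu (Nm h1 (evq 1 H))) (Iu v) ->
  Prodq E (Nm h0 (evq 0 H)) v w0 -> Prodq E (Nm h1 (evq 1 H)) v w1 -> heq E w0 w1.
Proof.
move=> hH e0 e1 c0 c1 p0 p1.
have [U [hU eU0 eU1 cU]] := moving_homotopy hH e0 e1 c0 c1.
have [W hW] := comax_Prodq (ETET EE) (noetherian_poly An) hU (QE_cst hv) cU.
have [QW _ _ _] := hW.
have P0 := Prodq_eval 0 cU hW; have P1 := Prodq_eval 1 cU hW; rewrite ?eU0 ?eU1 in P0 P1.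
have q0 : QE E (Nm h0 (evq 0 H)) by rewrite -eU0; apply: QE_ev.
have q1 : QE E (Nm h1 (evq 1 H)) by rewrite -eU1; apply: QE_ev.
apply: heq_trans (Prodq_uniq EE An q0 hv c0 p0 P0) _.
exact: heq_trans (heq_step QW) (Prodq_uniq EE An q1 hv c1 P1 p1).
Qed.

(** The intermediate triples of a zigzag need not be comaximal with [v]. Hence the statement
    quantifies over moves of both ends, and in the transitive case [moving] provides a move of the
    middle triple. *)
Lemma Prodq_moved u u' : heq E u u' -> QE E u -> forall h h' w w',
  h *m E = h -> h' *m E = h' -> comax (Iu (Nm h u)) (Iu v) -> comax (Iu (Nm h' u')) (Iu v) ->
  Prodq E (Nm h u) v w -> Prodq E (Nm h' u') v w' -> heq E w w'.
Proof.
elim=> {u u'} [u u' [H [hH <- <-]] _|u hu|u u' huu' IH hu|u x u' hux IH1 hxu' IH2 hu] h h' w w' hh hh' c c' p p'.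
- exact: (Prodq_homotopy hH hh hh' c c' p p').
- by apply: (@Prodq_homotopy (cstq u) h h' w w') => //; rewrite ?evq_cst //; exact: QE_cst.
- by apply: heq_sym; apply: (IH _ h' h w' w) => //; apply/(heq_QE huu').
have hx : QE E x by apply/(heq_QE hux).
have [g [gE _ cg _]] := moving hx (Iu_ideal v) (Iu_ideal v) nvn nvn.
have [y py] := comax_Prodq EE An (QE_Nm gE hx) hv cg.
by apply: heq_trans (IH1 hu h g w y hh gE c cg p py) (IH2 hx g h' y w' gE hh' cg c' py p').
Qed.

Lemma Prodq_heq u u' w w' : heq E u u' -> QE E u ->
  comax (Iu u) (Iu v) -> comax (Iu u') (Iu v) ->
  Prodq E u v w -> Prodq E u' v w' -> heq E w w'.
Proof.
move=> h hu c c' p p'; apply: (@Prodq_moved u u' h hu 0 0 w w'); rewrite ?mul0mx ?Nm0 //.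
Qed.
End Moving.


(** * From modules to matrices *)

Section Linear.
Variables (A : comNzRingType) (U V : lmodType A) (f : U -> V).
Hypothesis hf : is_linear f.

Lemma is_linear0 : f 0 = 0.
Proof.
have := hf 1 0 0; rewrite !scale1r addr0 => /eqP.
by rewrite -subr_eq subrr => /eqP.
Qed.
Lemma is_linearD x y : f (x + y) = f x + f y.
Proof. by have := hf 1 x y; rewrite !scale1r. Qed.
Lemma is_linearZ a x : f (a *: x) = a *: f x.
Proof. by have := hf a x 0; rewrite is_linear0 !addr0. Qed.
Lemma is_linear_sum (I : Type) (r : seq I) (P : pred I) (F : I -> U) :
  f (\sum_(i <- r | P i) F i) = \sum_(i <- r | P i) f (F i).
Proof. by apply: (big_morph f) => [x y|]; [exact: is_linearD | exact: is_linear0]. Qed.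
End Linear.

Lemma linf_linear (A : comNzRingType) (P : lmodType A) (f : P -> A) :
  linf f -> @is_linear A P A^o f.
Proof. by []. Qed.

Section Translation.
Variables (A : comNzRingType) (P : lmodType A) (m : nat).
Variables (i : P -> 'rV[A]_m) (q : 'rV[A]_m -> P).
Hypotheses (hi : is_linear i) (hq : is_linear q) (qi : forall x, q (i x) = x).

(** The matrix of [i] after [q] acting on columns: vectors are transposed because functionals are
    kept as rows. *)
Definition projE : 'M[A]_m := \matrix_(a, b) i (q (delta_mx 0 b)) 0 a.
Definition cvec (x : P) : 'cV[A]_m := (i x)^T.
Definition pvec (y : 'cV[A]_m) : P := q y^T.

Lemma cvecD x y : cvec (x + y) = cvec x + cvec y.
Proof. by rewrite /cvec (is_linearD hi) linearD. Qed.
Lemma cvecZ a x : cvec (a *: x) = a *: cvec x.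
Proof. by rewrite /cvec (is_linearZ hi) linearZ. Qed.
Lemma cvec_sum (I : Type) (r : seq I) (Q : pred I) (F : I -> P) :
  cvec (\sum_(k <- r | Q k) F k) = \sum_(k <- r | Q k) cvec (F k).
Proof. by rewrite /cvec (is_linear_sum hi) linear_sum. Qed.
Lemma cvec0 : cvec 0 = 0.
Proof. by rewrite /cvec (is_linear0 hi) linear0. Qed.
Lemma pvec0 : pvec 0 = 0.
Proof. by rewrite /pvec linear0 (is_linear0 hq). Qed.
Lemma pvec_sum (I : Type) (r : seq I) (Q : pred I) (F : I -> 'cV[A]_m) :
  pvec (\sum_(k <- r | Q k) F k) = \sum_(k <- r | Q k) pvec (F k).
Proof. by rewrite /pvec linear_sum (is_linear_sum hq). Qed.
Lemma cvecK x : pvec (cvec x) = x.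
Proof. by rewrite /pvec /cvec trmxK. Qed.

Lemma pvecE y : pvec y = \sum_b y b 0 *: q (delta_mx 0 b).
Proof.
rewrite /pvec {1}(row_sum_delta y^T) (is_linear_sum hq).
by apply: eq_bigr => b _; rewrite (is_linearZ hq) mxE.
Qed.

Lemma pvecK y : cvec (pvec y) = projE *m y.
Proof.
apply/colP => a; rewrite pvecE cvec_sum summxE mxE; apply: eq_bigr => b _.
by rewrite cvecZ !mxE mulrC.
Qed.

Lemma projE_cvec x : projE *m cvec x = cvec x.
Proof. by rewrite -pvecK cvecK. Qed.

Lemma projE_idem : projE *m projE = projE.
Proof.
apply/matrixP => a b; have := projE_cvec (q (delta_mx 0 b)).
move/colP/(_ a); rewrite !mxE => e; rewrite -[RHS]e; apply: eq_bigr => c _.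
by rewrite !mxE.
Qed.

(** A local basis at the kernel of [f] gives a matrix [M] of its coordinate columns, fixed by [E].
    Expressing the generators of [P] in the basis gives [B] with [B M] scalar and invertible after
    [f], so [M], and with it [E], has rank at least [n]. *)
Lemma rank_projE n : proj_rank P n -> forall (K : fieldType) (f : {rmorphism A -> K}),
  (n <= \rank (map_mx f projE))%N.
Proof.
move=> hn K f; have [e [se [gen ind]]] := hn (rker f) (rker_prime f).
have hgen (b : 'I_m) : exists t : A * ('I_n -> A), f t.1 != 0 /\
    t.1 *: q (delta_mx 0 b) = \sum_(k < n) t.2 k *: e`_k.
  have [s [ns [c [_ h]]]] := gen (q (delta_mx 0 b)).
  by exists (s, fun k : 'I_n => c`_k); split=> //; apply/eqP.
have [sb hsb] := fin_all_exists hgen.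
pose s := \prod_b (sb b).1.
have fs : f s != 0 by rewrite rmorph_prod; apply/prodf_neq0 => b _; case: (hsb b).
pose B : 'M[A]_(n, m) := \matrix_(k, b) ((\prod_(b' | b' != b) (sb b').1) * (sb b).2 k).
have hB b : s *: q (delta_mx 0 b) = \sum_(k < n) B k b *: e`_k.
  rewrite /s (bigD1 b) //= mulrC -scalerA (hsb b).2 scaler_sumr.
  by apply: eq_bigr => k _; rewrite mxE scalerA.
pose M : 'M[A]_(m, n) := \matrix_(a, k) i e`_k 0 a.
have colM k : col k M = cvec e`_k by apply/colP => a; rewrite !mxE.
(* Independence of the local basis holds only up to factors outside the kernel of [f], so the
   equality is obtained after [f]. *)
have BM k l : f ((B *m M) l k) = f (s *+ (l == k)).
  have rel : \sum_(l0 < n) ((B *m M) l0 k - s *+ (l0 == k)) *: e`_l0 = 0.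
    under eq_bigr do rewrite scalerBl.
    rewrite sumrB; have -> : \sum_(l0 < n) (s *+ (l0 == k)) *: e`_l0 = s *: e`_k.
      rewrite (bigD1 k) //= eqxx big1 ?addr0 // => j /negPf ->.
      by rewrite mulr0n scale0r.
    apply/eqP; rewrite subr_eq0; apply/eqP.
    rewrite -[X in _ = s *: X]cvecK pvecE scaler_sumr.
    under [RHS]eq_bigr do rewrite scalerA mulrC -scalerA hB scaler_sumr.
    rewrite exchange_big /=; apply: eq_bigr => j _; rewrite mxE scaler_suml.
    by apply: eq_bigr => b _; rewrite scalerA !mxE mulrC.
  pose c := mkseq (fun l0 => if insub l0 is Some l1 then (B *m M) l1 k - s *+ (l1 == k) else 0) n.
  have hc (l0 : 'I_n) : c`_l0 = (B *m M) l0 k - s *+ (l0 == k).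
    by rewrite nth_mkseq // valK.
  have [||s' [ns' hs']] := ind c _ _ l (ltn_ord l); first by rewrite size_mkseq.
    exists 1; split; first exact: (rker_prime f).2.1.
    by rewrite scale1r -[RHS]rel; apply: eq_bigr => j _; rewrite hc.
  have : f (s' * c`_l) = 0 by rewrite hs' rmorph0.
  move/eqP; rewrite rmorphM mulf_eq0 => /orP [/eqP //|]; rewrite hc rmorphB subr_eq0 => /eqP ->.
  by [].
have r1 : (n <= \rank (map_mx f M))%N.
  have : map_mx f B *m map_mx f M = (f s)%:M.
    by rewrite -map_mxM; apply/matrixP => l k; rewrite [LHS]mxE BM [RHS]mxE rmorphMn.
  move/(congr1 (@mxrank _ _ _)); rewrite -scalemx1 mxrank_scale_nz // mxrank1.
  by move=> e0; rewrite -[X in (X <= _)%N]e0; apply: mxrankM_maxr.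
have EM : projE *m M = M.
  apply/matrixP => a k; have := projE_cvec e`_k; rewrite -colM colE mulmxA -!colE.
  by move/colP/(_ a); rewrite [LHS]mxE [RHS]mxE.
by apply: leq_trans r1 _; rewrite -EM map_mxM; apply: mxrankM_maxl.
Qed.

Definition enc (u : rawT P) : qt A m := (\row_j u.1.1 (q (delta_mx 0 j)), cvec u.1.2, u.2).
Definition dec (e : qt A m) : rawT P := (fun y => dot e.1.1 (cvec y), pvec e.1.2, e.2).

Lemma dot_enc (f : P -> A) y : linf f -> dot (\row_j f (q (delta_mx 0 j))) y = f (pvec y).
Proof.
move=> hf; rewrite pvecE (is_linear_sum (linf_linear hf)) /dot mxE.
by apply: eq_bigr => b _; rewrite (is_linearZ (linf_linear hf)) mxE mulrC.
Qed.

Lemma linf_dot (f : 'rV[A]_m) : linf (fun y => dot f (cvec y)).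
Proof. by move=> a x y; rewrite cvecD cvecZ dotDr dotZr. Qed.

Lemma encK u : linf u.1.1 -> dec (enc u) = u.
Proof.
case: u => [[f p] s] /= hf; rewrite /dec /enc /= cvecK; congr (_, _, _).
by apply: functional_extensionality => y; rewrite dot_enc // cvecK.
Qed.

Lemma decK e : QE projE e -> enc (dec e) = e.
Proof.
case: e => [[f x] s] [/= h1 h2 _]; rewrite /enc /dec /= pvecK h2; congr (_, _, _).
rewrite -[RHS]h1; apply/rowP => j; rewrite !mxE /dot mxE; apply: eq_bigr => a _.
by rewrite !mxE.
Qed.

Lemma QtP_dec e : QE projE e -> QtP (dec e).
Proof. by move=> [h1 h2 h3]; split; [exact: linf_dot | rewrite /= pvecK h2]. Qed.

Lemma QE_enc u : QtP u -> QE projE (enc u).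
Proof.
case: u => [[f p] s] [/= hf he]; split=> /=.
- apply/rowP => b; rewrite [in RHS]mxE -(qi (q (delta_mx 0 b))).
  have := dot_enc (cvec (q (delta_mx 0 b))) hf; rewrite cvecK qi => <-.
  by rewrite /dot !mxE; apply: eq_bigr => a _; rewrite !mxE.
- exact: projE_cvec.
- by rewrite dot_enc // cvecK.
Qed.

Lemma Iu_dec e : QE projE e ->
  (fun a => exists x c, a = (dec e).1.1 x + c * (dec e).2) = Iu e.
Proof.
move=> [h1 _ _]; apply: pred_ext => a; split=> [[x [c ->]]|[y [c ->]]].
  by exists (cvec x), c.
by exists (pvec y), c; rewrite /= pvecK dotE.
Qed.

(** A coefficient sequence [p] becomes the column [sum_k T^k p_k], and a functional the row of its
    values on the generators [q (delta_mx 0 j)]. *)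
Lemma htp_enc u v : htp u v -> [/\ QtP u, QtP v & hom0 projE (enc u) (enc v)].
Proof.
move=> [[[F p] S] [[/= hF hE] [<- <-]]].
have F0 : F 0 = 0.
  by have := hF 1 0 0; rewrite scale1r addr0 mul1r => /eqP; rewrite -subr_eq subrr => /eqP.
have FZ a x : F (a *: x) = a%:P * F x by have := hF a x 0; rewrite F0 !addr0.
have FD x y : F (x + y) = F x + F y by have := hF 1 x y; rewrite scale1r mul1r.
pose Phi : 'rV[{poly A}]_m := \row_j F (q (delta_mx 0 j)).
have dPhi y : dot Phi (map_mx polyC y) = F (pvec y).
  rewrite pvecE (big_morph F FD F0) /dot mxE; apply: eq_bigr => b _.
  by rewrite FZ !mxE mulrC.
pose U : qt {poly A} m := (Phi, \sum_(k < size p) 'X^k *: map_mx polyC (cvec p`_k), S).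
have hU : QE (ET projE) U.
  split=> /=.
  - apply/rowP => b; rewrite [in RHS]mxE -(cvecK (q (delta_mx 0 b))) -dPhi.
    by rewrite /dot !mxE; apply: eq_bigr => a _; rewrite !mxE.
  - rewrite mulmx_sumr; apply: eq_bigr => k _.
    by rewrite -scalemxAr -map_mxM projE_cvec.
  - rewrite -[RHS]hE; congr (_ + _).
    rewrite (big_morph (dot Phi) (dotDr Phi) (dot0r Phi)); apply: eq_bigr => k _.
    by rewrite dotZr dPhi cvecK mulrC.
have e0 : evq 0 U = enc (ev0 (F, p, S)).
  rewrite /evq /mapq /enc /ev0 /=; congr (_, _, _).
    by apply/rowP => j; rewrite !mxE.
  rewrite map_mx_sum; case: p {hE U hU} => [|p0 p] /=; first by rewrite big_ord0 cvec0.
  rewrite big_ord_recl big1 => [|k _].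
    by rewrite addr0 map_mxZ ev_polyC evE expr0 hornerC scale1r.
  by rewrite map_mxZ evE hornerXn exprS mul0r scale0r.
have e1 : evq 1 U = enc (ev1 (F, p, S)).
  rewrite /evq /mapq /enc /ev1 /=; congr (_, _, _).
    by apply/rowP => j; rewrite !mxE.
  rewrite map_mx_sum cvec_sum; apply: eq_bigr => k _.
  by rewrite map_mxZ ev_polyC evE hornerXn expr1n scale1r.
have hlin t : linf (fun x => (F x).[t]).
  by move=> a x y; rewrite hF hornerD hornerM hornerC.
have qtp t z : enc z = evq t U -> z.1.1 = (fun x => (F x).[t]) -> QtP z.
  move=> e e'; have hz : linf z.1.1 by rewrite e'.
  by rewrite -(encK hz) e; apply/QtP_dec/QE_ev.
by split; [apply: (qtp 0) | apply: (qtp 1) | exists U].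
Qed.

Lemma hom0_dec e e' : hom0 projE e e' -> htp (dec e) (dec e').
Proof.
move=> [[[F X] S] [hU <- <-]]; have [/= h1 h2 h3] := hU.
(* One length for all entries of [X], positive so that evaluation at 0 finds a coefficient 0 in the
   sequence. *)
have [N [N0 hN]] : exists N, (0 < N)%N /\ forall a, (size (X a 0%R) <= N)%N.
  exists (\max_a size (X a 0%R)).+1; split=> // a; apply: ltnW; rewrite ltnS.
  exact: (leq_bigmax (F := fun a => size (X a 0%R))).
pose Xc k : 'cV[A]_m := \col_a (X a 0)`_k.
have eX : X = \sum_(k < N) 'X^k *: map_mx polyC (Xc k).
  apply/colP => a; rewrite summxE -[LHS]coefK poly_def.
  rewrite (big_ord_widen _ (fun k => (X a 0)`_k *: 'X^k) (hN a)) big_mkcond /=.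
  apply: eq_bigr => k _; rewrite !mxE mulrC mul_polyC.
  by case: ltnP => // h; rewrite nth_default // scale0r.
have ev t : map_mx (horner_eval t) X = \sum_(k < N) t ^+ k *: Xc k.
  rewrite {1}eX map_mx_sum; apply: eq_bigr => k _.
  by rewrite map_mxZ ev_polyC evE hornerXn.
have [sq [ssz snth]] : exists sq : seq P, size sq = N /\
    forall k, (k < N)%N -> sq`_k = pvec (Xc k).
  by exists (mkseq (fun k => pvec (Xc k)) N); rewrite size_mkseq; split=> // k hk; rewrite nth_mkseq.
have evf t : (fun y => (dot F (map_mx polyC (cvec y))).[t]) =
    (fun y => dot (map_mx (horner_eval t) F) (cvec y)).
  apply: functional_extensionality => y; rewrite -[in RHS](ev_polyC t (cvec y)).
  by rewrite dot_map.
exists (fun y => dot F (map_mx polyC (cvec y)), sq, S).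
split; last split.
- split=> /= [a x y|].
    by rewrite cvecD cvecZ map_mxD map_mxZ dotDr dotZr.
  rewrite ssz -[RHS]h3; congr (_ + _); rewrite -[in RHS]h2 [in RHS]eX mulmx_sumr.
  rewrite (big_morph (dot F) (dotDr F) (dot0r F)); apply: eq_bigr => k _.
  by rewrite snth // pvecK -scalemxAr dotZr map_mxM mulrC.
- rewrite /ev0 /dec /= evf; congr (_, _, _).
  rewrite snth // ev; congr pvec; rewrite (bigD1 (Ordinal N0)) //= expr0 scale1r.
  rewrite big1 ?addr0 // => k hk; rewrite expr0n; case: eqP => [h|_]; rewrite ?scale0r //.
  by case/eqP: hk; apply: val_inj.
- rewrite /ev1 /dec /= evf; congr (_, _, _).
  rewrite ev ssz pvec_sum; apply: eq_bigr => k _.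
  by rewrite snth // expr1n scale1r.
Qed.

Definition cls (e : qt A m) : rawT P -> Prop := Z0 (dec e).

Lemma clos_enc u v : clos_refl_sym_trans _ (@htp A P) u v -> heq projE (enc u) (enc v).
Proof.
elim=> {u v} [u v /htp_enc [_ _ h]|u|u v _ h|u v w _ h _ h'].
- exact: rst_step.
- exact: rst_refl.
- exact: heq_sym.
- exact: heq_trans h h'.
Qed.

Lemma clos_dec e e' : heq projE e e' -> clos_refl_sym_trans _ (@htp A P) (dec e) (dec e').
Proof.
elim=> {e e'} [e e' /hom0_dec h|e|e e' _ h|e e' e'' _ h _ h'].
- exact: rst_step.
- exact: rst_refl.
- exact: rst_sym.
- exact: rst_trans h h'.
Qed.

Lemma Z0_eq (u v : rawT P) : Z0 u = Z0 v <-> clos_refl_sym_trans _ (@htp A P) u v.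
Proof.
split=> [e|h].
  by rewrite -/(Z0 u v) e; apply: rst_refl.
apply: pred_ext => w; split=> h'; last exact: rst_trans h h'.
exact: rst_trans (rst_sym _ _ _ _ h) h'.
Qed.

Lemma cls_eq e e' : QE projE e -> QE projE e' -> cls e = cls e' <-> heq projE e e'.
Proof.
move=> h h'; rewrite /cls Z0_eq; split=> [/clos_enc|]; last exact: clos_dec.
by rewrite !decK.
Qed.

Lemma isPi0_cls x : isPi0 x <-> exists e, QE projE e /\ x = cls e.
Proof.
split=> [[u [hu ->]]|[e [he ->]]].
  by exists (enc u); split; [exact: QE_enc | rewrite /cls encK //; case: hu].
by exists (dec e); split=> //; apply: QtP_dec.
Qed.

Lemma Zeta_cls I w x : Zeta I w x <-> exists e, [/\ QE projE e, x = cls e, Iu e = I &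
  forall y, sqI I (dot e.1.1 (cvec y) - w y)].
Proof.
split=> [[u [hu [[h1 h2] ->]]]|[e [he -> eI h]]].
  have eu : dec (enc u) = u by apply: encK; case: hu.
  exists (enc u); split; first exact: QE_enc.
  - by rewrite /cls eu.
  - by rewrite -Iu_dec ?eu; [apply: pred_ext | exact: QE_enc].
  - by move=> y; have := h2 y; rewrite -{1}eu.
exists (dec e); split; first exact: QtP_dec.
by split=> //; split=> // a; rewrite -eI -Iu_dec.
Qed.

Definition AddE n e1 e2 e3 : Prop :=
  [/\ QE projE e1, QE projE e2, comax (Iu e1) (Iu e2), height_ge (Iu e1) n & Prodq projE e1 e2 e3].

Lemma LO_dec e : QE projE e -> LO (Iu e) (fun y => dot e.1.1 (cvec y)).
Proof.
move=> he; split; first exact: Iu_ideal.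
split; first exact: linf_dot.
split; first by move=> y; apply: Iu_dot.
move=> a /(Iu_mod_sq he) [y hy]; exists (pvec y).
by rewrite pvecK dotE //; case: he.
Qed.

(** A row fixed by [E] sees [y] only through [E y], which is the vector of an element of [P]. *)
Lemma dot_dec_all (I : A -> Prop) (f : 'rV[A]_m) : f *m projE = f ->
  (forall y, I (dot f (cvec y))) -> forall y, I (dot f y).
Proof. by move=> hf h y; rewrite -(dotE _ hf) -pvecK. Qed.

(** The representatives [wK], [wI], [w] agree with the functionals of the triples only modulo
    squares; adding up these congruences gives those of [Prodq]. Conversely the functionals
    themselves serve as representatives. *)
Lemma Add_cls n x y z : Add n x y z <->
  exists e1 e2 e3, [/\ x = cls e1, y = cls e2, z = cls e3 & AddE n e1 e2 e3].
Proof.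
split.
  move=> [K [wK [I [wI [w [hK [hI [/Zeta_cls ZK [/Zeta_cls ZI H]]]]]]]]].
  move: H => [hc [ht [_ [hwK [hwI /Zeta_cls ZKI]]]]].
  have [a [ha ea eK ka]] := ZK; have [b [hb eb eI kb]] := ZI.
  have [c [hc' ec eKI kc]] := ZKI.
  subst K I; exists a, b, c; split=> //; split=> //; split=> //.
    apply: (@dot_dec_all (sqI (Iu a))) => [|v].
      by case: hc' ha => h _ _ [h' _ _]; rewrite mulmxBl h h'.
    have hi2 := prodI_ideal (Iu a) (Iu_ideal a).
    have -> : dot (c.1.1 - a.1.1) (cvec v) = (dot c.1.1 (cvec v) - w v) + (w v - wK v)
       - (dot a.1.1 (cvec v) - wK v) by rewrite dotBl; ring.
    apply: (idealB hi2 (idealD hi2 _ (hwK v)) (ka v)).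
    apply: sqI_mono (kc v); first exact: Iu_ideal.
    by apply: prodI_sub => [|s t hs _]; [exact: Iu_ideal | apply: (ideal_mulr _ (Iu_ideal a))].
  apply: (@dot_dec_all (sqI (Iu b))) => [|v].
    by case: hc' hb => h _ _ [h' _ _]; rewrite mulmxBl h h'.
  have hi2 := prodI_ideal (Iu b) (Iu_ideal b).
  have -> : dot (c.1.1 - b.1.1) (cvec v) = (dot c.1.1 (cvec v) - w v) + (w v - wI v)
     - (dot b.1.1 (cvec v) - wI v) by rewrite dotBl; ring.
  apply: (idealB hi2 (idealD hi2 _ (hwI v)) (kb v)).
  apply: sqI_mono (kc v); first exact: Iu_ideal.
  by apply: prodI_sub => [|s t _ ht']; [exact: Iu_ideal | apply: (ideal_mull _ (Iu_ideal b))].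
move=> [a [b [c [-> -> -> [ha hb hc ht [hc' eI k1 k2]]]]]].
have zer e v : sqI (Iu e) (dot e.1.1 (cvec v) - dot e.1.1 (cvec v)).
  by rewrite subrr; apply: ideal0; apply: prodI_ideal; apply: Iu_ideal.
exists (Iu a), (fun y => dot a.1.1 (cvec y)), (Iu b), (fun y => dot b.1.1 (cvec y)),
  (fun y => dot c.1.1 (cvec y)).
split; first exact: LO_dec.
split; first exact: LO_dec.
split; first by apply/Zeta_cls; exists a; split.
split; first by apply/Zeta_cls; exists b; split.
split=> //; split=> //; rewrite -eI; split; first exact: LO_dec.
split; first by move=> v; rewrite -dotBl.
split; first by move=> v; rewrite -dotBl.
by apply/Zeta_cls; exists c; split.
Qed.

End Translation.


(** * The monoid *)

Lemma prodIC (R : comNzRingType) (I J : R -> Prop) : is_ideal I -> is_ideal J ->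
  prodI I J = prodI J I.
Proof.
have sub I' J' : is_ideal J' -> forall x : R, prodI I' J' x -> prodI J' I' x.
  move=> hJ; apply: prodI_sub; first exact: prodI_ideal.
  by move=> x y hx hy; rewrite mulrC; apply: prodI_mul.
by move=> hI hJ; apply: pred_ext => x; split; apply: sub.
Qed.

Section Prodq.
Variables (R : comNzRingType) (m : nat) (E : 'M[R]_m).
Implicit Types u v w : qt R m.

Lemma Prodq_sym u v w : Prodq E u v w -> Prodq E v u w.
Proof. by move=> [h1 h2 h3 h4]; split=> //; rewrite h2 prodIC //; apply: Iu_ideal. Qed.

Lemma comax_Iu_Prodq u v w (x : qt R m) : comax (Iu u) (Iu v) -> comax (Iu u) (Iu x) -> comax (Iu v) (Iu x) ->
  Prodq E u v w -> comax (Iu w) (Iu x).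
Proof.
move=> c1 c2 c3 [_ -> _ _]; rewrite comax_prodE //; try exact: Iu_ideal.
by apply: comax_cap => //; apply: Iu_ideal.
Qed.

Lemma height_Prodq n u v w : height_ge (Iu u) n -> height_ge (Iu v) n ->
  Prodq E u v w -> height_ge (Iu w) n.
Proof.
move=> hu hv [_ -> _ _] p pp hp.
have [h|/not_all_ex_not [a ha]] := classic (forall x, Iu u x -> p x); first exact: hu.
have [ua na] := imply_to_and _ _ ha; apply: hv => // b vb.
by case: (pp.2.2 a b (hp _ (prodI_mul ua vb))).
Qed.

(** The same [w] serves both bracketings. It is compared with [vx] through [v] and through [x], and
    the two congruences combine modulo the square of the intersection. *)
Lemma Prodq_assoc u v (x uv vx : qt R m) w : comax (Iu u) (Iu v) -> comax (Iu u) (Iu x) ->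
  comax (Iu v) (Iu x) -> Prodq E u v uv -> Prodq E v x vx -> Prodq E uv x w -> Prodq E u vx w.
Proof.
move=> c1 c2 c3 puv pvx pw.
have cw := comax_Iu_Prodq c1 c2 c3 puv.
have cu := comaxC (comax_Iu_Prodq c3 (comaxC c1) (comaxC c2) pvx).
case: puv pvx pw => [q1 e1 a1 b1] [q2 e2 a2 b2] [q3 e3 a3 b3].
have e1' : Iu uv = (fun y => Iu u y /\ Iu v y) by rewrite e1 comax_prodE //; apply: Iu_ideal.
have e2' : Iu vx = (fun y => Iu v y /\ Iu x y) by rewrite e2 comax_prodE //; apply: Iu_ideal.
have e3' : Iu w = (fun y => Iu uv y /\ Iu x y) by rewrite e3 comax_prodE //; apply: Iu_ideal.
have sq (z : qt R m) : is_ideal (sqI (Iu z)) := prodI_ideal (Iu z) (Iu_ideal z).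
have sub3 y (z t : qt R m) : dot (z.1.1 - t.1.1) y = dot (z.1.1 - uv.1.1) y + dot (uv.1.1 - t.1.1) y.
  by rewrite !dotBl; ring.
have wu y : sqI (Iu u) (dot (w.1.1 - u.1.1) y).
  rewrite sub3; apply: (idealD (sq u)) => //; apply: sqI_mono (a3 y); first exact: Iu_ideal.
  by rewrite e1' => z [].
have wv y : sqI (Iu v) (dot (w.1.1 - v.1.1) y).
  rewrite sub3; apply: (idealD (sq v)) => //; apply: sqI_mono (a3 y); first exact: Iu_ideal.
  by rewrite e1' => z [].
split=> //.
  rewrite e3' comax_prodE //; try exact: Iu_ideal.
  by rewrite e1' e2'; apply: pred_ext => y; tauto.
have sub3' y z : dot (w.1.1 - vx.1.1) y = dot (w.1.1 - z) y - dot (vx.1.1 - z) y.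
  by rewrite !dotBl; ring.
move=> y; rewrite e2'; apply: comax_sq_cap => //; try exact: Iu_ideal.
  by rewrite (sub3' _ v.1.1); apply: (idealB (sq v)).
by rewrite (sub3' _ x.1.1); apply: (idealB (sq x)).
Qed.
End Prodq.

Section Monoid.
Variables (A : comNzRingType) (P : lmodType A) (m d n : nat).
Variables (i : P -> 'rV[A]_m) (q : 'rV[A]_m -> P).
Hypotheses (hi : is_linear i) (hq : is_linear q) (qi : forall x, q (i x) = x).
Hypotheses (An : noetherian A) (Ad : krull_dim A d) (Pn : proj_rank P n) (dn : (d + 2 <= 2 * n)%N).

Local Notation E := (projE i q).
Local Notation cl := (cls i q).
Local Notation add := (@addPi A P n).
Implicit Types a b c e : qt A m.

Let EE : E *m E = E := projE_idem hi hq qi.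
Let rk := rank_projE hi hq qi Pn.
Let n0 : (0 < n)%N. Proof. by move: dn; lia. Qed.

Lemma no_chain_height e : height_ge (Iu e) n -> no_chain (Iu e) n.-1.
Proof. exact: (height_no_chain Ad dn). Qed.
Lemma no_chain_height_n e : height_ge (Iu e) n -> no_chain (Iu e) n.
Proof. by move/no_chain_height/no_chainS; rewrite prednK. Qed.

Lemma move_off e a b : QE E e -> height_ge (Iu a) n -> height_ge (Iu b) n ->
  exists e', [/\ QE E e', heq E e e', height_ge (Iu e') n, comax (Iu e') (Iu a) & comax (Iu e') (Iu b)].
Proof.
move=> he ha hb.
have [h [hE h1 h2 h3]] := moving EE An rk he (Iu_ideal a) (Iu_ideal b)
  (no_chain_height_n ha) (no_chain_height_n hb).
by exists (Nm h e); split=> //; [exact: QE_Nm | exact: heq_Nm].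
Qed.

Definition unitq : qt A m := (0, 0, 1).

Lemma Iu_unitq : Iu unitq = (fun _ => True).
Proof. by apply: pred_ext => x; split=> // _; exists 0, x; rewrite dot0r add0r mulr1. Qed.

Lemma QE_unitq : QE E unitq.
Proof. by split; rewrite /= ?mul0mx ?mulmx0 // dot0r add0r mul1r subrr. Qed.

Lemma height_unitq : height_ge (Iu unitq) n.
Proof. by rewrite Iu_unitq => p [_ [h1 _]] h; case: h1; apply: h. Qed.

(** Only [e1] and [e1'] have controlled height. A triple [f] equivalent to [e2], of height at least
    [n] and comaximal with both, allows one factor to be exchanged at a time, the other always
    having the required height: [e1 e2], [e1 f], [e1' f], [e1' e2']. *)
Lemma AddE_uniq e1 e2 e3 e1' e2' e3' : AddE i q n e1 e2 e3 -> AddE i q n e1' e2' e3' ->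
  heq E e1 e1' -> heq E e2 e2' -> heq E e3 e3'.
Proof.
move=> [q1 q2 c t p] [q1' q2' c' t' p'] h1 h2.
have [f [qf hf tf fc fc']] := move_off q2 t t'.
have [y py] := comax_Prodq EE An q1 qf (comaxC fc).
have [y' py'] := comax_Prodq EE An q1' qf (comaxC fc').
have s1 : heq E e3 y.
  apply: (Prodq_heq EE An rk q1 n0 (no_chain_height t) hf q2 (comaxC c) fc); exact: Prodq_sym.
have s2 : heq E y y'.
  exact: (Prodq_heq EE An rk qf n0 (no_chain_height tf) h1 q1 (comaxC fc) (comaxC fc') py py').
have s3 : heq E y' e3'.
  apply: (Prodq_heq EE An rk q1' n0 (no_chain_height t') _ qf fc' (comaxC c')); try exact: Prodq_sym.
  exact: heq_trans (heq_sym hf) h2.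
exact: heq_trans (heq_trans s1 s2) s3.
Qed.

(** The value picked by [epsilon] comes from some other choice of triples, and [AddE_uniq]
    identifies it with [cl e3]. *)
Lemma addPi_cls e1 e2 e3 : AddE i q n e1 e2 e3 -> add (cl e1) (cl e2) = cl e3.
Proof.
move=> h; have [_ _ _ _ [q3 _ _ _]] := h.
have ex : exists z, isPi0 z /\ Add n (cl e1) (cl e2) z.
  exists (cl e3); split; first by apply/(isPi0_cls hi hq qi); exists e3.
  by apply/(Add_cls hi hq qi); exists e1, e2, e3.
have [_ /(Add_cls hi hq qi) [f1 [f2 [f3 [x1 x2 x3 h']]]]] := epsilon_spec (inhabits (@e0 _ P)) _ ex.
have [r1 r2 _ _ [r3 _ _ _]] := h'; have [q1 q2 _ _ _] := h.
rewrite -[add _ _]/(epsilon _ _) x3; apply/(cls_eq hi hq qi) => //.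
by apply: (AddE_uniq h' h); apply/(cls_eq hi hq qi).
Qed.

Lemma cls_move e a b : QE E e -> height_ge (Iu a) n -> height_ge (Iu b) n ->
  exists e', [/\ QE E e', cl e = cl e', height_ge (Iu e') n, comax (Iu e') (Iu a) & comax (Iu e') (Iu b)].
Proof.
move=> he ha hb; have [f [qf hf tf fc fc']] := move_off he ha hb.
by exists f; split=> //; apply/(cls_eq hi hq qi).
Qed.

Lemma cls_triple x y z : isPi0 x -> isPi0 y -> isPi0 z -> exists a b c,
  [/\ [/\ x = cl a, y = cl b & z = cl c], [/\ QE E a, QE E b & QE E c],
   [/\ height_ge (Iu a) n, height_ge (Iu b) n & height_ge (Iu c) n] &
   [/\ comax (Iu a) (Iu b), comax (Iu a) (Iu c) & comax (Iu b) (Iu c)]].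
Proof.
move=> /(isPi0_cls hi hq qi) [x' [hx ->]] /(isPi0_cls hi hq qi) [y' [hy ->]]
  /(isPi0_cls hi hq qi) [z' [hz ->]].
(* Comaximality with the unit ideal is automatic, so this first move only secures the height. *)
have [a [qa ea ta _ _]] := cls_move hx height_unitq height_unitq.
have [b [qb eb tb cb _]] := cls_move hy ta ta.
have [c [qc ec tc ca cb']] := cls_move hz ta tb.
by exists a, b, c; split; split=> //; exact: comaxC.
Qed.

Lemma isPi0_add x y : isPi0 x -> isPi0 y -> isPi0 (add x y).
Proof.
move=> hx hy; have [a [b [_ [[-> -> _] [qa qb _] [ta _ _] [cab _ _]]]]] := cls_triple hx hy hy.
have [w pw] := comax_Prodq EE An qa qb cab; have [qw _ _ _] := pw.
rewrite (@addPi_cls a b w); last by split.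
by apply/(isPi0_cls hi hq qi); exists w.
Qed.

Lemma addPiC x y : isPi0 x -> isPi0 y -> add x y = add y x.
Proof.
move=> hx hy; have [a [b [_ [[-> -> _] [qa qb _] [ta tb _] [cab _ _]]]]] := cls_triple hx hy hy.
have [w pw] := comax_Prodq EE An qa qb cab.
rewrite (@addPi_cls a b w); last by split.
by rewrite (@addPi_cls b a w) //; split=> //; [exact: comaxC | exact: Prodq_sym].
Qed.

Lemma addPiA x y z : isPi0 x -> isPi0 y -> isPi0 z -> add (add x y) z = add x (add y z).
Proof.
move=> hx hy hz.
have [a [b [c [[-> -> ->] [qa qb qc] [ta tb tc] [cab cac cbc]]]]] := cls_triple hx hy hz.
have [u pu] := comax_Prodq EE An qa qb cab; have [v pv] := comax_Prodq EE An qb qc cbc.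
have [qu _ _ _] := pu; have [qv _ _ _] := pv.
have cuc := comax_Iu_Prodq cab cac cbc pu.
have cav := comaxC (comax_Iu_Prodq cbc (comaxC cab) (comaxC cac) pv).
have [w pw] := comax_Prodq EE An qu qc cuc.
rewrite (@addPi_cls a b u); last by split.
rewrite (@addPi_cls b c v); last by split.
rewrite (@addPi_cls u c w); last by split=> //; exact: height_Prodq pu.
rewrite (@addPi_cls a v w) //; split=> //; exact: (Prodq_assoc cab cac cbc pu pv pw).
Qed.

Lemma dec_unitq : dec i q unitq = @raw1 A P.
Proof.
rewrite /dec /raw1 /unitq /= pvec0 //; congr (_, _, _).
by apply: functional_extensionality => y; rewrite dot0l.
Qed.

Lemma dec_zero : dec i q (0, 0, 0) = @raw0 A P.
Proof.
rewrite /dec /raw0 /= pvec0 //; congr (_, _, _).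
by apply: functional_extensionality => y; rewrite dot0l.
Qed.

(** Since [unitq] has the unit ideal, [a] itself is a product of [a] and [unitq]. *)
Lemma addPi_e1 x : isPi0 x -> add x (@e1 _ P) = x.
Proof.
move=> hx; have [a [_ [_ [[-> _ _] [qa _ _] [ta _ _] _]]]] := cls_triple hx hx hx.
have -> : @e1 _ P = cl unitq by rewrite /cls dec_unitq.
apply: addPi_cls; split=> //; first exact: QE_unitq.
  by exists 0, 1; rewrite Iu_unitq add0r; split=> //; apply: ideal0; apply: Iu_ideal.
split=> //; rewrite ?Iu_unitq.
- apply: pred_ext => x0; split; first by move=> h; rewrite -(mulr1 x0); apply: prodI_mul.
  by apply: prodI_sub => [|s t hs _]; [exact: Iu_ideal | apply: (ideal_mulr _ (Iu_ideal a))].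
- by move=> y; rewrite subrr dot0l; apply: ideal0; apply: prodI_ideal; apply: Iu_ideal.
- by move=> y; rewrite -[dot _ _]mulr1; apply: prodI_mul.
Qed.

Lemma GamPi_cls e : QE E e -> GamPi (cl e) = cl (Gamq e).
Proof.
move=> he; have ex : exists y, exists u, QtP u /\ cl e = Z0 u /\ y = Z0 (Gam u).
  by exists (cl (Gamq e)), (dec i q e); split=> //; apply: QtP_dec.
have [u [hu [eu ey]]] := epsilon_spec (inhabits (@e0 _ P)) _ ex.
rewrite -[GamPi _]/(epsilon _ _) ey.
have hu' : dec i q (enc i q u) = u by apply: encK => //; case: hu.
have qu := QE_enc hi hq qi hu.
have -> : Z0 (Gam u) = cl (Gamq (enc i q u)) by rewrite /cls -{1}hu'.
apply/(cls_eq hi hq qi); try exact: QE_Gam.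
by apply: heq_Gam; apply/(cls_eq hi hq qi) => //; rewrite eu /cls hu'.
Qed.

Lemma addPi_GamPi x : isPi0 x -> isPi0 (GamPi x) /\ add x (GamPi x) = @e0 _ P.
Proof.
move=> hx; have [a [_ [_ [[-> _ _] [qa _ _] [ta _ _] _]]]] := cls_triple hx hx hx.
have qg := QE_Gam qa; rewrite GamPi_cls //; split.
  by apply/(isPi0_cls hi hq qi); exists (Gamq a).
pose z : qt A m := (a.1.1, 0, 0).
have qz : QE E z by case: (qa) => h1 _ _; split; rewrite /= ?mulmx0 // dot0r mul0r addr0.
have cag : comax (Iu a) (Iu (Gamq a)).
  exists a.2, (1 - a.2); split; first exact: Iu_s.
  by split; [exact: (Iu_s (Gamq a)) | rewrite addrC subrK].
rewrite (@addPi_cls a (Gamq a) z).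
  have -> : @e0 _ P = cl (0, 0, 0) by rewrite /cls dec_zero.
  have q0 : QE E (0, 0, 0) by split; rewrite /= ?mulmx0 ?mul0mx // dot0r mul0r addr0.
  apply/(cls_eq hi hq qi) => //; apply: heq_sym; apply: rst_step.
  exists ('X *: map_mx polyC a.1.1, 0, 0); case: qa => h1 _ _; split.
  - split; rewrite /= ?mulmx0 ?dot0r ?mul0r ?addr0 //.
    by rewrite -scalemxAl -map_mxM h1.
  - rewrite /evq /mapq /= map_mx0 map_mxZ evE hornerX scale0r.
    by rewrite rmorph0.
  - rewrite /evq /mapq /= map_mx0 map_mxZ ev_polyC evE hornerX scale1r.
    by rewrite rmorph0.
split=> //; split=> //.
- rewrite comax_prodE //; try exact: Iu_ideal.
  apply: pred_ext => b; split.
    by move=> [y [c ->]]; rewrite /= mulr0 addr0; split; [apply: Iu_dot | apply: (Iu_dot (Gamq a))].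
  (* An element [b] of both ideals is [(1 - s) b + s b], and both terms lie in the image of the
     functional. *)
  move=> [ha hb]; have [y hy] := Iu_mul1s qa ha; have [y' hy'] := Iu_mul1s qg hb.
  exists (y + y'), 0; rewrite /= mulr0 addr0 dotDr -hy; move: hy' => /= <-; ring.
- by move=> y; rewrite subrr dot0l; apply: ideal0; apply: prodI_ideal; apply: Iu_ideal.
- by move=> y; rewrite subrr dot0l; apply: ideal0; apply: prodI_ideal; apply: Iu_ideal.
Qed.

End Monoid.

(** With [pr] the projection to [A] and [pr e = 1], the path is [(0, 0, 0) ~ (0, e, 0) ~ (pr, 0, 1)
    ~ (0, 0, 1)]; its middle step is [(T pr, (1 - T) e, T)]. *)
Lemma e0_eq_e1 (A : comNzRingType) (P Q : lmodType A) (phi : P -> (Q * A^o)%type) :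
  is_linear phi -> bijective phi -> @e0 _ P = @e1 _ P.
Proof.
move=> hphi [psi phiK psiK].
pose pr y : A := (phi y).2; pose e := psi (0, 1).
have hpr : linf pr by move=> a x y; rewrite /pr hphi.
have hpe : pr e = 1 by rewrite /pr psiK.
have prN : pr (- e) = - 1.
  have h := linf_linear hpr; have := is_linearZ h (-1) e.
  by rewrite scaleN1r /= => ->; rewrite hpe scaleN1r.
have step u v : @htp A P u v -> clos_refl_sym_trans _ (@htp A P) u v by exact: rst_step.
apply/Z0_eq.
have s1 : htp (fun _ : P => 0 : A, e, 0 : A) (@raw0 A P).
  exists (fun _ => 0, [:: e; - e], 0); split; last split.
  - split=> /= [a x y|]; first by rewrite mulr0 addr0.
    by rewrite big1 ?mul0r ?addr0 // => j _; rewrite mul0r.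
  - by rewrite /ev0 /= horner0.
  - by rewrite /ev1 /raw0 /= !big_ord_recl big_ord0 /= addr0 subrr horner0.
have s2 : htp (fun _ : P => 0 : A, e, 0 : A) (pr, 0, 1).
  exists (fun y => (pr y)%:P * 'X, [:: e; - e], 'X); split; last split.
  - split=> /= [a x y|]; first by rewrite hpr polyCD polyCM mulrDl mulrA.
    rewrite !big_ord_recl big_ord0 /= hpe prN polyCN polyC1; ring.
  - rewrite /ev0 /= hornerX; congr (_, _, _).
    by apply: functional_extensionality => y; rewrite hornerMX mulr0.
  - rewrite /ev1 /= !big_ord_recl big_ord0 /= addr0 subrr hornerX; congr (_, _, _).
    by apply: functional_extensionality => y; rewrite hornerMX mulr1 hornerC.
have s3 : htp (@raw1 A P) (pr, 0, 1).
  exists (fun y => (pr y)%:P * 'X, [::], 1); split; last split.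
  - split=> /= [a x y|]; first by rewrite hpr polyCD polyCM mulrDl mulrA.
    by rewrite big_ord0 subrr mulr0 addr0.
  - rewrite /ev0 /= hornerC; congr (_, _, _).
    by apply: functional_extensionality => y; rewrite hornerMX mulr0.
  - rewrite /ev1 /= big_ord0 hornerC; congr (_, _, _).
    by apply: functional_extensionality => y; rewrite hornerMX mulr1 hornerC.
apply: rst_trans (rst_sym _ _ _ _ (step _ _ s1)) _.
exact: rst_trans (step _ _ s2) (rst_sym _ _ _ _ (step _ _ s3)).
Qed.

Theorem theorem5p11 (A : comNzRingType) (k : fieldType) (iota : {rmorphism k -> A})
  (d n : nat) (P : lmodType A) :
  (2%:R : k) != 0 -> regular_ring A -> krull_dim A d ->
  fg_projective P -> proj_rank P n -> (d + 2 <= 2 * n)%N ->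
  [/\ (* (1) abelian monoid with identity e1 *)
      (forall x y : rawT P -> Prop, isPi0 x -> isPi0 y -> isPi0 (addPi n x y)) /\
      (forall x y : rawT P -> Prop, isPi0 x -> isPi0 y -> addPi n x y = addPi n y x),
      (forall x y z : rawT P -> Prop, isPi0 x -> isPi0 y -> isPi0 z ->
         addPi n (addPi n x y) z = addPi n x (addPi n y z)),
      (forall x : rawT P -> Prop, isPi0 x -> addPi n x (@e1 _ P) = x),
      (* (2) *)
      (forall x : rawT P -> Prop, isPi0 x -> isPi0 (GamPi x) /\ addPi n x (GamPi x) = @e0 _ P) &
      (* (3) *)
      ((@e0 _ P = @e1 _ P -> forall x : rawT P -> Prop, isPi0 x -> exists y : rawT P -> Prop, isPi0 y /\ addPi n x y = @e1 _ P) /\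
       (forall Q : lmodType A, fg_projective Q ->
          (exists phi : P -> (Q * A^o)%type, is_linear phi /\ bijective phi) ->
          forall x : rawT P -> Prop, isPi0 x -> exists y : rawT P -> Prop, isPi0 y /\ addPi n x y = @e1 _ P))].
Proof.
move=> _ [An _] Ad [m [i [q [hi [hq qi]]]]] Pn dn.
have inverse := addPi_GamPi hi hq qi An Ad Pn dn.
have group : @e0 _ P = @e1 _ P -> forall x : rawT P -> Prop, isPi0 x ->
    exists y, isPi0 y /\ addPi n x y = @e1 _ P.
  by move=> e x /inverse [h1 h2]; exists (GamPi x); rewrite -e.
split.
- by split=> x y; [apply: isPi0_add | apply: addPiC]; eassumption.
- by move=> x y z; apply: addPiA; eassumption.
- by move=> x; apply: addPi_e1; eassumption.
- exact: inverse.
- split=> // Q _ [phi [hphi bphi]]; apply: group; exact: e0_eq_e1 hphi bphi.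
Qed.
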